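(* Assume $\lambda_0<+\infty$. Let $\epsilon>0$ and $\delta\in(0,1)$. For every $t\ge1$ let $\psi=\psi_{t,\delta}$ satisfy $\psi_{t,\delta}\ge2^{30}\log^4(5t/\delta)$, and run the algorithm OSE with tuning parameters $\beta_t=6\log(5t/\delta)$. Then, with probability at least $1-\delta$, for any $t\ge 4\,\psi_{t,\delta}\,H(\epsilon)$, the recommendation $\hat r_t$ of OSE satisfies $$\lambda_{\gamma(\hat r_t)}\ge\lambda_0-\epsilon.$$
   Context: **Model.** The set of arms is $\mathcal A=\{1,2,\dots\}$. The function $\eta\mapsto\lambda_\eta$ from $(0,1]$ to $\mathbb R$ is nonincreasing and right-continuous, and $\lambda_0:=\lim_{\eta\to0^+}\lambda_\eta$. The ranks $(\gamma(a))_{a\ge1}$ are independent and uniform on $[0,1]$. Arm $a$ produces rewards $X_{a,s}=\lambda_{\gamma(a)}+\varepsilon_{a,s}$, $s\ge1$, where the noise variables $\varepsilon_{a,s}$ are independent (over all $a,s$, and independent of the ranks), centered, and $\zeta^2$-sub-Gaussian: $\mathbb E[e^{\theta\varepsilon_{a,s}}]\le \exp(\zeta^2\theta^2/2)$ for all $\theta\in\mathbb R$, with $\zeta>0$. At each time $t=1,2,\dots$ the learner pulls one arm $\hat a_t$, chosen from past observations (and independent internal randomness), and observes $X_{\hat a_t,N_{\hat a_t,t}}$, where $N_{a,t}=\sum_{t'=1}^t\mathbf 1\{\hat a_{t'}=a\}$. It then outputs a recommendation $\hat r_t\in\mathcal A$. The learner does not know the ranks or the function $\lambda$. **Confidence bounds.**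 With $\overline X_{a,t}=\frac1{N_{a,t}}\sum_{s=1}^{N_{a,t}}X_{a,s}$, set $\mathrm{UCB}_{a,t}=\overline X_{a,t}+\sqrt{\zeta^2\beta_t/N_{a,t}}$ and $\mathrm{LCB}_{a,t}=\overline X_{a,t}-\sqrt{\zeta^2\beta_t/N_{a,t}}$. If $N_{a,t}=0$, set $\mathrm{UCB}_{a,t}=+\infty$ and $\mathrm{LCB}_{a,t}=-\infty$. **Algorithm OSE** (Optimistic Scope Exploration). At each time $t=1,2,\dots$: draw $U_t\sim\mathcal U(0,1)$ independently of everything else; set $Z_t=\lfloor t^{U_t}\rfloor$; pull $\hat a_t\in\arg\max_{a\le Z_t}\mathrm{UCB}_{a,t-1}$; recommend $\hat r_t\in\arg\max_{a\in\mathcal A}\mathrm{LCB}_{a,t}$. Among unsampled arms, the one with smallest index is pulled first, so that the sampled arms always form an initial segment of $\{1,2,\dots\}$. **Sample complexity.** For $\eta\in[0,1]$ let $\Delta_\eta=\lambda_0-\lambda_\eta$. For $\epsilon>0$ let $g(\epsilon)=\sup\{\eta\in[0,1]:\ \Delta_\eta\le\epsilon\}$ and $$H(\epsilon)=\max\Big(\frac1{g(\epsilon/2)},\ \sup_{g(\epsilon)\le\eta\le1}\frac{\zeta^2\eta}{g(\epsilon/2)\,\Delta_\eta^2}\Big),$$ where a quotient with $\Delta_\eta=0$ is $+\infty$. $\log$ is the natural logarithm. *)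

(* Defs.v *)
From HB Require Import structures.
From mathcomp Require Import all_boot all_order all_algebra.
From mathcomp Require Import finmap.
From mathcomp Require Import all_classical all_reals all_analysis.
Set Implicit Arguments.
Unset Strict Implicit.
Unset Printing Implicit Defensive.
Import Order.TTheory GRing.Theory Num.Theory.
Import numFieldNormedType.Exports.
Local Open Scope classical_set_scope.
Local Open Scope ring_scope.

(* Arms, pull counts and times are natural numbers starting at 1; families
   indexed by them are functions on nat whose values at 0 are never used. *)

(** Expected rewards *)

(* Only the values of [lam] on ]0, 1] are meaningful. *)
Definition quantile_function (R : realType) (lam : R -> R) : Prop :=
  (forall x y : R, 0 < x -> x <= y -> y <= 1 -> lam y <= lam x) /\
  (forall x : R, 0 < x -> x < 1 -> lam u @[u --> x^'+] --> lam x).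

(* The limit always exists in \bar R for nonincreasing [lam], possibly +oo. *)
Definition lambda0 (R : realType) (lam : R -> R) : \bar R :=
  lim ((lam x)%:E @[x --> 0^'+]).

Definition lambda (R : realType) (lam : R -> R) (eta : R) : \bar R :=
  if eta == 0 then lambda0 lam else (lam eta)%:E.

Definition Delta (R : realType) (lam : R -> R) (eta : R) : \bar R :=
  (lambda0 lam - lambda lam eta)%E.

(** Sample complexity *)

Definition scope_fraction (R : realType) (lam : R -> R) (e : R) : R :=
  sup [set eta : R | 0 <= eta <= 1 /\ (Delta lam eta <= e%:E)%E].

(* The inverse of \bar R satisfies 0^-1 = +oo, which gives the value +oo to the
   quotients where [Delta lam eta = 0]. *)
Definition complexity (R : realType) (lam : R -> R) (zeta e : R) : \bar R :=
  let g := scope_fraction lam in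
  maxe ((g (e / 2))%:E^-1)%E
    (ereal_sup
      [set ((zeta ^+ 2 * eta)%:E / ((g (e / 2))%:E * Delta lam eta ^+ 2))%E
        | eta in [set eta : R | g e <= eta <= 1]]).

(** Independence *)

Definition independent_classes d (T : measurableType d) (R : realType)
    (P : probability T R) (I : choiceType) (D : set I)
    (F : I -> set (set T)) : Prop :=
  forall (J : {fset I}) (E : I -> set T),
    (forall i, i \in J -> D i /\ F i (E i)) ->
    P (\bigcap_(i in [set` J]) E i) = (\prod_(i <- J) P (E i))%E.

(* The primitive sources of randomness: the ranks of the arms, the noise
   variables, the variables U_t, and all the other internal randomness of the
   learner, which can only be used to break ties. *)
Inductive source : Type :=
  | Rank of nat
  | Noise of nat & nat
  | Scope of nat
  | TieBreak.

HB.instance Definition _ := gen_eqMixin source.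
HB.instance Definition _ := gen_choiceMixin source.

Definition valid_source : set source := [set i | match i with
  | Rank a => (1 <= a)%N
  | Noise a s => (1 <= a)%N && (1 <= s)%N
  | Scope t => (1 <= t)%N
  | TieBreak => true
  end].

Definition source_events d (T : measurableType d) (R : realType)
    (P : probability T R) dV (TV : measurableType dV)
    (gamma : nat -> {RV P >-> R}) (noise : nat -> nat -> {RV P >-> R})
    (U : nat -> {RV P >-> R}) (V : {mfun T >-> TV}) (i : source) :
    set (set T) :=
  match i with
  | Rank a => preimage_set_system setT (gamma a) measurable
  | Noise a s => preimage_set_system setT (noise a s) measurable
  | Scope t => preimage_set_system setT (U t) measurable
  | TieBreak => preimage_set_system setT V measurable
  end.

(** The infinite-armed bandit *)

Record bandit_model d (T : measurableType d) (R : realType)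
    (P : probability T R) dV (TV : measurableType dV) (zeta : R)
    (gamma : nat -> {RV P >-> R}) (noise : nat -> nat -> {RV P >-> R})
    (U : nat -> {RV P >-> R}) (V : {mfun T >-> TV}) : Prop := BanditModel {
  rank_range : forall a w, (1 <= a)%N -> 0 <= gamma a w <= 1;
  rank_uniform : forall (a : nat) (B : set R), (1 <= a)%N -> measurable B ->
    distribution P (gamma a) B = uniform_prob (@ltr01 R) B;
  noise_centered : forall a s, (1 <= a)%N -> (1 <= s)%N ->
    ('E_P[noise a s] = 0)%E;
  noise_subgaussian : forall a s (theta : R), (1 <= a)%N -> (1 <= s)%N ->
    ('M_P (noise a s) theta <= (expR (zeta ^+ 2 * theta ^+ 2 / 2))%:E)%E;
  scope_range : forall t w, (1 <= t)%N -> 0 < U t w < 1;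
  scope_uniform : forall (t : nat) (B : set R), (1 <= t)%N -> measurable B ->
    distribution P (U t) B = uniform_prob (@ltr01 R) B;
  sources_independent :
    independent_classes P valid_source (source_events gamma noise U V)
}.

(* [fine] is harmless: [lambda0 lam] is the only possibly infinite value, and
   it is finite as soon as [lambda0 lam < +oo]. *)
Definition reward (T : Type) (R : realType) (lam : R -> R)
    (gamma : nat -> T -> R) (noise : nat -> nat -> T -> R)
    (a s : nat) (w : T) : R :=
  fine (lambda lam (gamma a w)) + noise a s w.

Definition pulls (T : Type) (hata : nat -> T -> nat) (a t : nat) (w : T) : nat :=
  (\sum_(1 <= t' < t.+1) (hata t' w == a))%N.

Definition observation (T : Type) (R : realType) (X : nat -> nat -> T -> R)
    (hata : nat -> T -> nat) (t : nat) (w : T) : R :=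
  X (hata t w) (pulls hata (hata t w) t w) w.

Definition empirical_mean (T : Type) (R : realType) (X : nat -> nat -> T -> R)
    (hata : nat -> T -> nat) (a t : nat) (w : T) : R :=
  (\sum_(1 <= s < (pulls hata a t w).+1) X a s w) / (pulls hata a t w)%:R.

Definition UCB (T : Type) (R : realType) (X : nat -> nat -> T -> R)
    (hata : nat -> T -> nat) (zeta : R) (beta : nat -> R)
    (a t : nat) (w : T) : \bar R :=
  if pulls hata a t w == 0%N then +oo%E
  else (empirical_mean X hata a t w
        + Num.sqrt (zeta ^+ 2 * beta t / (pulls hata a t w)%:R))%:E.

Definition LCB (T : Type) (R : realType) (X : nat -> nat -> T -> R)
    (hata : nat -> T -> nat) (zeta : R) (beta : nat -> R)
    (a t : nat) (w : T) : \bar R :=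
  if pulls hata a t w == 0%N then -oo%E
  else (empirical_mean X hata a t w
        - Num.sqrt (zeta ^+ 2 * beta t / (pulls hata a t w)%:R))%:E.

(** The algorithm *)

Definition is_argmax (R : realType) (A : set nat) (f : nat -> \bar R)
    (a : nat) : Prop :=
  A a /\ forall b, A b -> (f b <= f a)%E.

Definition scope_size (T : Type) (R : realType) (U : nat -> T -> R)
    (t : nat) (w : T) : nat :=
  Num.truncn (t%:R `^ U t w).

(* The sigma-algebra of what the learner knows after observing the rewards of
   times 1, ..., k and drawing U_1, ..., U_t. *)
Definition known (d dV : measure_display) (T : measurableType d)
    (R : realType) (TV : measurableType dV) (X : nat -> nat -> T -> R)
    (U : nat -> T -> R) (V : T -> TV) (hata : nat -> T -> nat)
    (k t : nat) : set (set T) :=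
  <<s [set A | [\/ preimage_set_system setT V measurable A,
       exists2 t', (1 <= t' <= t)%N &
         preimage_set_system setT (U t') measurable A,
       exists2 t', (1 <= t' <= k)%N &
         preimage_set_system setT (hata t') setT A |
       exists2 t', (1 <= t' <= k)%N &
         preimage_set_system setT (observation X hata t') measurable A]] >>.

(* [hata] and [hatr] are a run of OSE; ties left undetermined by the algorithm
   are broken arbitrarily, by a rule that is measurable with respect to what the
   learner knows. *)
Record OSE_run (d dV : measure_display) (T : measurableType d)
    (R : realType) (TV : measurableType dV) (X : nat -> nat -> T -> R)
    (U : nat -> T -> R) (V : T -> TV) (zeta : R) (beta : nat -> R)
    (hata hatr : nat -> T -> nat) : Prop := OSERun {
  pull_argmax : forall t w, (1 <= t)%N ->
    is_argmax [set a | (1 <= a <= scope_size U t w)%N]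
      (fun a => UCB X hata zeta beta a t.-1 w) (hata t w);
  pull_smallest_unsampled : forall t w, (1 <= t)%N ->
    pulls hata (hata t w) t.-1 w = 0%N ->
    forall b, (1 <= b < hata t w)%N -> (0 < pulls hata b t.-1 w)%N;
  recommend_argmax : forall t w, (1 <= t)%N ->
    is_argmax [set a | (1 <= a)%N]
      (fun a => LCB X hata zeta beta a t w) (hatr t w);
  pull_adapted : forall t a, (1 <= t)%N ->
    known X U V hata t.-1 t (hata t @^-1` [set a]);
  recommend_adapted : forall t a, (1 <= t)%N ->
    known X U V hata t t (hatr t @^-1` [set a])
}.

(* Main.v *)
Require Import Defs.
From mathcomp Require Import all_boot all_order all_algebra.
From mathcomp Require Import finmap.
From mathcomp Require Import all_classical all_reals all_analysis.
From mathcomp Require Import measurable_realfun.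
From mathcomp Require Import ring lra zify.
Set Implicit Arguments.
Unset Strict Implicit.
Unset Printing Implicit Defensive.
Import Order.TTheory GRing.Theory Num.Theory.
Import numFieldNormedType.Exports.
Local Open Scope classical_set_scope.
Local Open Scope ring_scope.

(** Why the theorem is true.  Write L = log(5t/delta), p = g(epsilon/2), and call
    gap of an arm the difference between lambda_0 and its mean reward.

    Fix a time t >= 4 psi_t H(epsilon), and suppose that the noise averages stay
    within the confidence radii and that the arm r recommended at time t has gap
    larger than epsilon.  Among the first k of order L/p arms, one has rank below
    p, hence gap at most epsilon/2; call it b.  At a time s <= t whose scope has
    size between k and 2k, the arm b is a candidate, so the arm a which is pulled
    has a UCB at least lambda_0 - epsilon/2.  If a was already pulled n times,
    its gap is at most epsilon/2 + 2 rho, where rho^2 = zeta^2 beta_t / n.  Since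
    moreover the LCB of a is at most that of r at time t, the gap of r is at most
    epsilon/2 + 4 rho.  Both gaps being compared with epsilon, this gives
    D <= 8 rho, where D is the gap at the rank max(g(epsilon), rank of a)
    (gap_pulled_le).  The condition on t turns this into an upper bound on n
    proportional to p / max(p, rank of a) (pulls_scope_le), and a summation over
    the first 2k arms bounds the number of times whose scope has size between k
    and 2k (scope_window_le).

    This bound is too small to be true.  The scope size t^U falls between k and
    2k with probability log 2 / log t, so at least about t/L times of the second
    half of [1, t] have such a scope (thin_window_tail).  On the other hand
    p / max(p, rank) has expectation about p log(1/p), so that its sum over 2k
    arms is of order L^2 (inverse_rank_excess_tail), and the bound of the
    previous paragraph is then of order L^3 t / psi_t.  The two are incompatible
    as psi_t >= 2^30 L^4 (few_pulls_absurd).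

    All the probabilistic estimates are instances of one Chernoff bound for sums
    over independent sources (chernoff_indep), which rests on the
    multiplicativity of expectations.  The failure probabilities at time t add
    up to at most delta / (t (t + 1)), whose sum over t is delta. *)

(** * Expectation of a product of independent variables, and the Chernoff bound *)

Section independence.
Context d (T : measurableType d) (R : realType) (P : probability T R).

Local Open Scope ereal_scope.
Import HBNNSimple.

(** Approximating f by the simple functions phi_n o f, whose level sets are
    preimages under f, reduces the claim to the hypothesis on preimages; monotone
    convergence then concludes.  Only preimages under f occur in the hypothesis,
    which is what makes an induction over a family of variables possible. *)
Lemma integral_mul_indep (h : T -> R) (f : T -> R) (c : R) :
    measurable_fun setT h -> (forall x, 0 <= h x)%R ->
    measurable_fun setT f -> (forall x, 0 <= f x)%R ->
    (0 <= c)%R ->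
    (forall B, measurable B ->
      \int[P]_(x in f @^-1` B) (h x)%:E = c%:E * P (f @^-1` B)) ->
  \int[P]_x ((f x)%:E * (h x)%:E) = c%:E * \int[P]_x (f x)%:E.
Proof.
move=> mh h0 mf f0 c0 hB.
(* The absolute value extends f >= 0 to an approximable function on the reals. *)
have mn : measurable_fun [set: R] (EFin \o (fun y : R => `|y|%R)).
  by apply/measurable_EFinP; exact: normr_measurable.
pose phi := nnsfun_approx measurableT mn.
have cphi x : (phi n (f x))%:E @[n --> \oo] --> (f x)%:E.
  rewrite -[in X in _ --> X](ger0_norm (f0 x)).
  exact: (@cvg_nnsfun_approx _ _ _ _ measurableT _ mn (fun y _ => (normr_ge0 y : 0 <= `|y|%:E)) (f x) I).
have ndphi x m n : (m <= n)%N -> (phi m (f x) <= phi n (f x))%R.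
  by move=> mn'; apply/lefP; exact: nd_nnsfun_approx.
have mphi n : measurable_fun setT (fun x => phi n (f x)).
  have m1 : measurable_fun [set: R] (phi n : R -> R) by [].
  exact: (measurableT_comp m1 mf).
have mind (B : set R) : measurable B -> measurable_fun setT (fun x => \1_B (f x) : R).
  move=> mB; have m1 : measurable_fun [set: R] (\1_B : R -> R).
    exact: measurable_indic.
  exact: (measurableT_comp m1 mf).
have step n : \int[P]_x ((phi n (f x))%:E * (h x)%:E) =
    c%:E * \int[P]_x (phi n (f x))%:E.
  have mpre y : measurable (f @^-1` (phi n @^-1` [set y])).
    by rewrite -[X in measurable X]setTI; apply: mf.
  have ind_pre y x : \1_(phi n @^-1` [set y]) (f x) =
      \1_(f @^-1` (phi n @^-1` [set y])) x :> R by rewrite !indicE.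
  under eq_integral => x _.
    rewrite fimfunE -fsumEFin// ge0_mule_fsuml; last first.
      move=> y; rewrite EFinM nnfun_muleindic_ge0 //.
    over.
  rewrite ge0_integral_fsum//=; last 2 first.
  - move=> y; apply: emeasurable_funM; last exact/measurable_EFinP.
    by apply/measurable_EFinP/measurable_funM => //; exact: mind.
  - move=> y x _; apply: mule_ge0; last by rewrite lee_fin.
    by rewrite EFinM nnfun_muleindic_ge0.
  under [in RHS]eq_integral => x _ do rewrite fimfunE -fsumEFin//.
  rewrite ge0_integral_fsum//=; last 2 first.
  - by move=> y; apply/measurable_EFinP/measurable_funM => //; exact: mind.
  - by move=> y x _; rewrite EFinM nnfun_muleindic_ge0.
  rewrite ge0_mule_fsumr; last first.
    move=> y; apply: integral_ge0 => x _.
    by rewrite EFinM nnfun_muleindic_ge0.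
  apply: eq_fsbigr => y; rewrite inE => -[r _ <-].
  set y' := phi n r.
  have y0 : (0 <= y')%R by [].
  under eq_integral => x _ do rewrite EFinM -muleA.
  rewrite ge0_integralZl//=; last 2 first.
  - apply: emeasurable_funM; last exact/measurable_EFinP.
    by apply/measurable_EFinP; exact: mind.
  - by move=> x _; rewrite mule_ge0// lee_fin.
  under [in RHS]eq_integral => x _ do rewrite EFinM.
  rewrite [in RHS]ge0_integralZl//=; last first.
    by apply/measurable_EFinP; exact: mind.
  rewrite muleCA; congr (_ * _).
  under [in RHS]eq_integral => x _ do rewrite ind_pre.
  rewrite integral_indic// setIT -hB; last first.
    by rewrite -[X in measurable X]setTI; exact: measurable_funPT.
  rewrite [in RHS]integral_mkcond; apply: eq_integral => x _.
  rewrite ind_pre patchE indicE; case: ifP => _; by rewrite ?mul1e ?mul0e.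
have h1 := @cvg_monotone_convergence _ _ _ P setT measurableT
  (fun n x => (phi n (f x))%:E * (h x)%:E).
have h2 := @cvg_monotone_convergence _ _ _ P setT measurableT
  (fun n x => (phi n (f x))%:E).
have e1 : \int[P]_x ((phi n (f x))%:E * (h x)%:E) @[n --> \oo] -->
   \int[P]_x ((f x)%:E * (h x)%:E).
  rewrite (_ : \int[P]_x ((f x)%:E * (h x)%:E) = \int[P]_x limn (fun n => (phi n (f x))%:E * (h x)%:E)); last first.
    apply: eq_integral => x _; apply/esym/cvg_lim => //.
    by apply: cvgeM => //; exact: cvg_cst.
  apply: h1.
  - by move=> n; apply: emeasurable_funM; exact/measurable_EFinP.
  - by move=> n x _; rewrite mule_ge0// lee_fin.
  - by move=> x _ m n mn'; rewrite lee_wpmul2r ?lee_fin// ndphi.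
have e2 : \int[P]_x (phi n (f x))%:E @[n --> \oo] --> \int[P]_x (f x)%:E.
  rewrite (_ : \int[P]_x (f x)%:E = \int[P]_x limn (fun n => (phi n (f x))%:E)); last first.
    by apply: eq_integral => x _; apply/esym/cvg_lim.
  apply: h2.
  - by move=> n; exact/measurable_EFinP.
  - by move=> n x _; rewrite lee_fin.
  - by move=> x _ m n mn'; rewrite lee_fin ndphi.
rewrite -(cvg_lim _ e1)//; under eq_fun => n do rewrite step.
by apply/cvg_lim => //; exact: cvgeZl.
Qed.
End independence.

Section product.
Context d (T : measurableType d) (R : realType) (P : probability T R).

Local Open Scope ereal_scope.

(** Lets the ranks, or the noise of one arm, inherit the independence of all the
    sources in their own indexing; the left inverse g transports events back. *)
Lemma independent_classes_reindex (I J : choiceType) (f : J -> I) (g : I -> J)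
    (D : set I) (F : I -> set (set T)) :
  cancel f g -> independent_classes P D F ->
  independent_classes P (f @^-1` D) (F \o f).
Proof.
move=> fK indep K E KE.
have inj_f := can_inj fK.
have := indep (f @` K)%fset (E \o g).
rewrite big_imfset//=; last by move=> x y _ _; exact: inj_f.
have -> : \prod_(i <- K) P (E (g (f i))) = \prod_(i <- K) P (E i).
  by apply: eq_bigr => i _; rewrite fK.
move=> <-.
- congr (P _); apply/seteqP; split => [x Ex i /= /imfsetP[j /= jK ->]|x Ex i /= iK].
    by rewrite fK; exact: Ex.
  by have := Ex (f i); rewrite /= fK; apply; exact: in_imfset.
- by move=> i /imfsetP[j /= jK ->]; rewrite fK; exact: KE.
Qed.

Context (I : choiceType) (D : set I) (F : I -> set (set T)).
Hypothesis indep : independent_classes P D F.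
Hypothesis F_measurable : forall i, D i -> F i `<=` measurable.

Definition adapted_to (i : I) (h : T -> R) :=
  forall B, measurable B -> F i (h @^-1` B).

Lemma adapted_measurable i h : D i -> adapted_to i h -> measurable_fun setT h.
Proof.
by move=> Di hF _ B mB; rewrite setTI; exact/(F_measurable Di)/hF.
Qed.

(** Independence is a product rule for events; it is turned into a product rule
    for functions one index at a time.  The indices of s1 already carry
    functions, those of s2 still carry events, and the induction on s1 moves its
    head to s2, where it carries arbitrary preimages. *)
Lemma integral_prod_bigcap (s1 s2 : seq I) (h : I -> T -> R) (E : I -> set T) :
    uniq (s1 ++ s2) -> (forall i, i \in s1 ++ s2 -> D i) ->
    (forall i, i \in s1 -> adapted_to i (h i)) ->
    (forall i x, i \in s1 -> 0 <= h i x)%R ->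
    (forall i, i \in s1 -> \int[P]_x (h i x)%:E \is a fin_num) ->
    (forall i, i \in s2 -> F i (E i)) ->
  \int[P]_(x in \bigcap_(i in [set` s2]) E i) (\prod_(i <- s1) h i x)%:E =
  \prod_(i <- s1) (\int[P]_x (h i x)%:E) * \prod_(i <- s2) P (E i).
Proof.
have mcap (s : seq I) (E' : I -> set T) : (forall i, i \in s -> D i) ->
    (forall i, i \in s -> F i (E' i)) -> measurable (\bigcap_(i in [set` s]) E' i).
  move=> sD sF; apply: fin_bigcap_measurable => [|i si].
    exact: finite_seq.
  exact/(F_measurable (sD _ si))/sF.
elim: s1 s2 E => [|i s1 IH] s2 E us sD hF h0 hfin EF.
  rewrite big_nil mul1e.
  under eq_integral => x _ do rewrite big_nil.
  rewrite integral_cst ?mul1e; last exact: mcap.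
  have -> : [set` s2] = [set` [fset i in s2]%fset].
    by apply/seteqP; split => i /=; rewrite in_fset.
  transitivity (\prod_(i <- [fset i in s2]%fset) P (E i)).
    by apply: indep => i; rewrite in_fset => si; split; [exact: sD|exact: EF].
  apply: perm_big; apply: uniq_perm => //.
  by move=> i; rewrite in_fset.
have /= /andP[is12 us12] := us.
have is1 : i \in i :: s1 by rewrite inE eqxx.
have Di : D i by apply: sD; rewrite mem_cat is1.
have s1s j : j \in s1 -> j \in i :: s1 by rewrite inE => ->; rewrite orbT.
have mh j : j \in i :: s1 -> measurable_fun setT (h j).
  by move=> js; apply: (@adapted_measurable j); [apply: sD; rewrite mem_cat js|exact: hF].
have mE : measurable (\bigcap_(i in [set` s2]) E i).
  by apply: mcap => // j js; apply: sD; rewrite mem_cat js orbT.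
pose g x := (\prod_(j <- s1) h j x * \1_(\bigcap_(i in [set` s2]) E i) x)%R.
pose c := \prod_(j <- s1) (\int[P]_x (h j x)%:E) * \prod_(j <- s2) P (E j).
have hint j : j \in i :: s1 -> 0 <= \int[P]_x (h j x)%:E.
  by move=> js; apply: integral_ge0 => x _; rewrite lee_fin h0.
have c_ge0 : 0 <= c.
  apply: mule_ge0; last by apply: prode_ge0.
  by rewrite big_seq; apply: prode_ge0 => j /s1s; exact: hint.
have c_fin : c \is a fin_num.
  rewrite fin_numM//; last first.
    rewrite big_seq; apply: prode_fin_num => j js; apply: fin_num_measure.
    by apply: (F_measurable (i := j)); [apply: sD; rewrite mem_cat js orbT|exact: EF].
  rewrite big_seq; apply: prode_fin_num => j /s1s; exact: hfin.
transitivity (\int[P]_x ((h i x)%:E * (g x)%:E)).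
  rewrite integral_mkcond; apply: eq_integral => x _.
  rewrite patchE /g indicE big_cons; case: ifP => _.
    by rewrite mulr1 EFinM.
  by rewrite mulr0 mule0.
rewrite (@integral_mul_indep _ _ _ _ g (h i) (fine c)).
- by rewrite fineK// big_cons muleC /c muleA.
- rewrite /g; apply: measurable_funM; last exact: measurable_indic.
  by apply: measurable_prod => j js; exact/mh/s1s.
- move=> x; rewrite mulr_ge0// big_seq; apply: prodr_ge0 => j /s1s js; exact: h0.
- exact: mh.
- by move=> x; exact: h0.
- by rewrite fine_ge0.
- move=> B mB; rewrite fineK//.
  (* The head i joins the events with a preimage under h i. *)
  pose E' j := if j == i then h i @^-1` B else E j.
  have E's j : j \in s2 -> E' j = E j.
    move=> js; rewrite /E'; case: eqP => // ji.
    by move: is12; rewrite -ji mem_cat js orbT.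
  have E'i : E' i = h i @^-1` B by rewrite /E' eqxx.
  have := IH (i :: s2) E'; rewrite big_cons E'i.
  have -> : \prod_(j <- s2) P (E' j) = \prod_(j <- s2) P (E j).
    by apply: eq_big_seq => j js; rewrite E's.
  rewrite muleCA [X in _ -> _ = X]muleC => <-.
  + rewrite integral_mkcond [RHS]integral_mkcond; apply: eq_integral => x _.
    rewrite !patchE /g indicE.
    have -> : (x \in \bigcap_(j in [set` i :: s2]) E' j) =
       (x \in h i @^-1` B) && (x \in \bigcap_(j in [set` s2]) E j).
      apply/idP/andP; rewrite !inE.
        move=> EE; split; first by have := EE i; rewrite E'i; apply => /=; rewrite inE eqxx.
        by move=> j js; have := EE j; rewrite E's//; apply => /=; rewrite inE (js : j \in s2) orbT.
      move=> [hB EE] j /=; rewrite inE => /orP[/eqP ->|js]; first by rewrite /E' eqxx.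
      by rewrite E's//; exact: EE.
    by case: (x \in h i @^-1` B) => /=; case: (x \in \bigcap_(j in [set` s2]) E j) => /=; rewrite ?mulr1 ?mulr0.
  + by rewrite (perm_uniq (permEl (@perm_catCA I s1 [:: i] s2))) /= is12.
  + move=> j; rewrite (perm_mem (permEl (@perm_catCA I s1 [:: i] s2))); exact: sD.
  + by move=> j /s1s; exact: hF.
  + by move=> j x /s1s; exact: h0.
  + by move=> j /s1s; exact: hfin.
  + move=> j; rewrite inE => /orP[/eqP ->|js]; last by rewrite E's//; exact: EF.
    by rewrite /E' eqxx; exact: hF.
Qed.

Lemma expectation_prod (s : seq I) (h : I -> T -> R) :
    uniq s -> (forall i, i \in s -> D i) ->
    (forall i, i \in s -> adapted_to i (h i)) ->
    (forall i x, i \in s -> 0 <= h i x)%R ->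
    (forall i, i \in s -> \int[P]_x (h i x)%:E \is a fin_num) ->
  \int[P]_x (\prod_(i <- s) h i x)%:E = \prod_(i <- s) (\int[P]_x (h i x)%:E).
Proof.
move=> us sD hF h0 hfin.
have := @integral_prod_bigcap s [::] h (fun=> setT).
rewrite cats0 big_nil mule1 => <- //.
by congr integral; apply/seteqP; split.
Qed.

Lemma chernoff_indep (s : seq I) (X : I -> T -> R) (c : I -> R) (x : R) :
    uniq s -> (forall i, i \in s -> D i) ->
    (forall i, i \in s -> adapted_to i (X i)) ->
    (forall i, i \in s -> \int[P]_w (expR (X i w))%:E <= (expR (c i))%:E) ->
  P [set w | (\sum_(i <- s) c i + x <= \sum_(i <- s) X i w)%R] <= (expR (- x))%:E.
Proof.
move=> us sD XF Xc.
pose S w := (\sum_(i <- s) X i w)%R.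
have mS : measurable_fun setT S.
  have -> : S = (fun x => \sum_(j <- s) (if j \in s then X j x else 0))%R.
    by apply/funext => w; rewrite /S big_seq [RHS]big_seq; apply: eq_bigr => j ->.
  apply: measurable_sum => j; case js: (j \in s) => //; apply: (@adapted_measurable j); [exact: sD|exact: XF].
pose S' : {RV P >-> R} := mfun_Sub (mem_set mS).
have := @chernoff _ _ _ P S' 1 (\sum_(i <- s) c i + x) ltr01.
move=> /le_trans; apply.
rewrite /mmt_gen_fun unlock mul1r opprD expRD.
have e : \int[P]_w (expR (S w))%:E <= (expR (\sum_(i <- s) c i))%:E.
  under eq_integral => w _ do rewrite /S expR_sum.
  rewrite (@expectation_prod s (fun i w => expR (X i w)))//; last 2 first.
  - move=> i js B mB.
    have := XF i js (expR @^-1` B); apply.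
    by rewrite -[X in measurable X]setTI; exact: measurable_expR.
  - move=> i js; rewrite ge0_fin_numE; first exact: (le_lt_trans (Xc _ js) (ltry _)).
    by apply: integral_ge0 => w _; rewrite lee_fin expR_ge0.
  have fin i : i \in s -> \int[P]_w (expR (X i w))%:E =
      (fine (\int[P]_w (expR (X i w))%:E))%:E.
    move=> js; rewrite fineK// ge0_fin_numE.
      exact: (le_lt_trans (Xc _ js) (ltry _)).
    by apply: integral_ge0 => w _; rewrite lee_fin expR_ge0.
  rewrite (eq_big_seq _ fin) prodEFin expR_sum lee_fin.
  rewrite big_seq [leRHS]big_seq; apply: ler_prod => i js; apply/andP; split.
    by apply: fine_ge0; apply: integral_ge0 => w _; rewrite lee_fin expR_ge0.
  by rewrite -lee_fin -fin//; exact: Xc.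
apply: (@le_trans _ _ ((expR (\sum_(i <- s) c i))%:E *
  (expR (- \sum_(i <- s) c i) * expR (- x))%:E)).
  apply: lee_wpmul2r; first by rewrite lee_fin mulr_ge0 ?expR_ge0.
  by under eq_integral => w _ do rewrite /= mulr1.
by rewrite -EFinM mulrA -expRD subrr expR0 mul1r.
Qed.

End product.

(** * Uniform variables and moment generating functions *)

Section uniform.
Context (R : realType).
Local Open Scope ereal_scope.

Lemma uniform_prob01E (B : set R) : measurable B ->
  uniform_prob (@ltr01 R) B = lebesgue_measure (B `&` `[0%R, 1%R]).
Proof.
move=> mB; rewrite /uniform_prob integral_uniform_pdf.
under eq_integral => x.
  rewrite inE => -[_ /=]; rewrite in_itv/= /uniform_pdf => ->; rewrite subr0 invr1; over.
rewrite integral_cst ?mul1e//; exact: measurableI.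
Qed.

Lemma uniform_prob_lt (x : R) : (0 <= x)%R ->
  uniform_prob (@ltr01 R) `]-oo, x[ <= x%:E.
Proof.
move=> x0; rewrite uniform_prob01E//.
apply: (@le_trans _ _ (lebesgue_measure (`[0%R, x] : set R))).
  apply: le_measure; rewrite ?inE//; first exact: measurableI.
  by move=> y /=; rewrite !in_itv/= => -[yx /andP[-> _]]; rewrite ltW.
rewrite lebesgue_measure_itv/= lte_fin; case: ltP => // _.
by rewrite sube0.
Qed.

Lemma uniform_prob_lt_ge (x : R) : (0 <= x <= 1)%R ->
  x%:E <= uniform_prob (@ltr01 R) `]-oo, x[.
Proof.
move=> /andP[x0 x1]; rewrite uniform_prob01E//.
apply: (@le_trans _ _ (lebesgue_measure (`[0%R, x[ : set R))).
  rewrite lebesgue_measure_itv/= lte_fin; case: ltP => // x0'.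
  by rewrite sube0.
apply: le_measure; rewrite ?inE//; first exact: measurableI.
move=> y /=; rewrite !in_itv/= => /andP[-> yx]; split => //.
by rewrite ltW// (lt_le_trans yx).
Qed.

Lemma uniform_prob_itv_ge (x y : R) : (0 <= x)%R -> (y <= 1)%R ->
  (y - x)%:E <= uniform_prob (@ltr01 R) `[x, y].
Proof.
move=> x0 y1; rewrite uniform_prob01E//.
apply: (@le_trans _ _ (lebesgue_measure (`[x, y] : set R))).
  rewrite lebesgue_measure_itv/= lte_fin; case: ltP => // yx.
  by rewrite lee_fin subr_le0.
apply: le_measure; rewrite ?inE//; first exact: measurableI.
move=> z /=; rewrite !in_itv/= => /andP[xz zy]; rewrite xz zy; split => //.
by rewrite (le_trans x0 xz) (le_trans zy).
Qed.
End uniform.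

Section mgf.
Context d (T : measurableType d) (R : realType) (P : probability T R).

Lemma measurable_set_le (f g : T -> R) :
  measurable_fun setT f -> measurable_fun setT g ->
  measurable [set w | f w <= g w].
Proof.
by move=> mf mg; rewrite -[X in measurable X]setTI; exact: measurable_fun_le.
Qed.

Lemma measurable_set_lt (f g : T -> R) :
  measurable_fun setT f -> measurable_fun setT g ->
  measurable [set w | f w < g w].
Proof.
move=> mf mg.
rewrite (_ : mkset _ = ~` [set w | g w <= f w]); last first.
  by apply/seteqP; split => w /=; rewrite ltNge => /negP.
exact/measurableC/measurable_set_le.
Qed.

(** From exp(-1) <= 1/2 the left-hand side is at most 1 - p/2.  This is the
    Chernoff exponent for lower tails of counts. *)
Lemma mgf_opp_indicator (A : set T) (p : R) : measurable A ->
    (p%:E <= P A)%E ->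
  (\int[P]_w (expR (- \1_A w))%:E <= (expR (- (p / 2)))%:E)%E.
Proof.
move=> mA pA.
have e12 : expR (- 1) <= 1 / 2 :> R.
  rewrite expRN div1r lef_pV2 ?posrE ?expR_gt0//.
  by have := @expR_ge1Dx R 1; rewrite -[1 + 1]/(2%:R).
have finA : P A \is a fin_num by exact: fin_num_measure.
apply: (@le_trans _ _ (\int[P]_w ((1 / 2)%:E * (\1_A w)%:E + (\1_(~` A) w)%:E))%E).
  apply: ge0_le_integral => //.
  - apply/measurable_EFinP; apply: (measurableT_comp (@measurable_expR R)).
    by apply: measurableT_comp => //; exact: measurable_indic.
  - apply/measurable_EFinP; apply: measurable_funD.
      by apply: measurable_funM => //; exact: measurable_indic.
    by apply: measurable_indic; exact: measurableC.
  - move=> w _; rewrite -EFinM -EFinD lee_fin !indicE in_setC.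
    case: (w \in A) => /=; first by rewrite mulr1 addr0.
    by rewrite mulr0 add0r oppr0 expR0.
rewrite ge0_integralD//; last 2 first.
- apply/measurable_EFinP; apply: measurable_funM => //; exact: measurable_indic.
- by apply/measurable_EFinP; apply: measurable_indic; exact: measurableC.
rewrite ge0_integralZl//; last first.
  by apply/measurable_EFinP; exact: measurable_indic.
rewrite !integral_indic ?setIT//; last exact: measurableC.
suff : ((1 / 2)%:E * P A + P (~` A) <= (expR (- (p / 2)))%:E)%E by [].
rewrite probability_setC// -(fineK finA) -EFinM -EFinB -EFinD lee_fin.
have pA' : p <= fine (P A) by rewrite -lee_fin fineK.
have := @expR_ge1Dx R (- (p / 2)); lra.
Qed.

(** Halving Y makes exp(Y/2) <= 1 + Y hold on [0, 1] by exp(-y) >= 1 - y alone;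
    a domination of Y by a combination of indicators then replaces the
    computation of its expectation. *)
Lemma mgf_half_le (Y : T -> R) (J : nat) (b : nat -> R) (A : nat -> set T) (m : nat -> R) :
    measurable_fun setT Y -> (forall w, 0 <= Y w <= 1) ->
    (forall j, measurable (A j)) -> (forall j, 0 <= b j) ->
    (forall w, Y w <= \sum_(j < J) b j * \1_(A j) w) ->
    (forall j, (P (A j) <= (m j)%:E)%E) ->
  (\int[P]_w (expR (Y w / 2))%:E <= (expR (\sum_(j < J) b j * m j))%:E)%E.
Proof.
move=> mY Y01 mA b0 YA Pm.
apply: (@le_trans _ _ (\int[P]_w (1 + \sum_(j < J) (b j)%:E * (\1_(A j) w)%:E))%E).
  apply: ge0_le_integral => //.
  - apply/measurable_EFinP; apply: (measurableT_comp (@measurable_expR R)).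
    by apply: measurable_funM.
  - apply: emeasurable_funD => //; apply: emeasurable_sum => j.
    by apply/measurable_EFinP; apply: measurable_funM => //; exact: measurable_indic.
  - move=> w _; have /andP[y0 y1] := Y01 w.
    under eq_bigr => j _ do rewrite -EFinM.
    rewrite sumEFin -EFinD lee_fin; apply: (@le_trans _ _ (1 + Y w)); last by rewrite lerD2l.
    rewrite -[expR _]invrK -expRN invf_ple ?posrE ?expR_gt0//; last by lra.
    apply: (@le_trans _ _ (1 - Y w / 2)); last first.
      by have := @expR_ge1Dx R (- (Y w / 2)); lra.
    rewrite -div1r ler_pdivrMr; last by lra.
    nra.
have mAi j : measurable_fun setT (fun w => (b j)%:E * (\1_(A j) w)%:E)%E.
  by apply/measurable_EFinP; apply: measurable_funM => //; exact: measurable_indic.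
have bA0 j w : (0 <= (b j)%:E * (\1_(A j) w)%:E)%E by rewrite mule_ge0// lee_fin.
rewrite ge0_integralD//; last 2 first.
- by move=> w _; exact: sume_ge0.
- by apply: emeasurable_sum.
rewrite integral_cst// mul1e ge0_integral_sum//.
have -> : (P : {measure set T -> \bar R}) setT = 1%E by exact: probability_setT.
apply: (@le_trans _ _ (1 + \sum_(j < J) (b j * m j)%:E)%E); last first.
  by rewrite sumEFin -EFinD lee_fin; exact: expR_ge1Dx.
apply: leeD => //; apply: lee_sum => j _.
rewrite ge0_integralZl//; last 2 first.
- by apply/measurable_EFinP; exact: measurable_indic.
- by rewrite lee_fin.
rewrite integral_indic// setIT EFinM.
by apply: lee_wpmul2l; [rewrite lee_fin|exact: Pm].
Qed.

End mgf.

(** * Deviation bounds for the sources of randomness *)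

Section tails.
Context (R : realType) (d : measure_display) (T : measurableType d)
  (P : probability T R) (dV : measure_display) (TV : measurableType dV).
Variables (zeta : R) (gamma : nat -> {RV P >-> R})
  (noise : nat -> nat -> {RV P >-> R}) (U : nat -> {RV P >-> R})
  (V : {mfun T >-> TV}).
Hypothesis hzeta : 0 < zeta.
Hypothesis hmodel : bandit_model zeta gamma noise U V.

Lemma preimage_system_measurable d' (T' : measurableType d') (X : T -> T') :
  measurable_fun setT X ->
  preimage_set_system setT X measurable `<=` (measurable : set (set T)).
Proof. by move=> mX _ [B mB <-]; exact: mX. Qed.

Lemma source_events_measurable i :
  source_events gamma noise U V i `<=` (measurable : set (set T)).
Proof. by case: i => [a|a s|t|] /=; exact: preimage_system_measurable. Qed.

Lemma chernoff_sources (f : nat -> source) (g : source -> nat)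
    (Y : nat -> {RV P >-> R}) (phi : nat -> R -> R) (c : nat -> R)
    (s : seq nat) (x : R) :
    cancel f g ->
    (forall j, source_events gamma noise U V (f j) =
               preimage_set_system setT (Y j) measurable) ->
    uniq s -> (forall j, j \in s -> valid_source (f j)) ->
    (forall j, measurable_fun setT (phi j)) ->
    (forall j, j \in s ->
      (\int[P]_w (expR (phi j (Y j w)))%:E <= (expR (c j))%:E)%E) ->
  (P [set w | (\sum_(j <- s) c j + x <= \sum_(j <- s) phi j (Y j w))%R] <=
   (expR (- x))%:E)%E.
Proof.
move=> fK eY us sv mphi Yc.
have ind := independent_classes_reindex fK (sources_independent hmodel).
have Fm j : (f @^-1` valid_source) j ->
    (source_events gamma noise U V \o f) j `<=` (measurable : set (set T)).
  by move=> _; exact: source_events_measurable.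
apply: (chernoff_indep ind Fm (X := fun j w => phi j (Y j w))) => //.
- move=> j js B mB /=; rewrite eY; exists (phi j @^-1` B).
    by rewrite -[X in measurable X]setTI; exact: mphi.
  by rewrite setTI.
Qed.

Lemma sum_const_seq (a n : nat) (c : R) :
  \sum_(j <- index_iota a (a + n)) c = n%:R * c.
Proof. by rewrite big_const_seq count_predT size_iota addKn iter_addr_0 mulr_natl. Qed.

(** With the exponent theta of the hypothesis, the sum of n sub-Gaussian
    exponents is b/2, and the threshold b leaves b/2.  Both signs of theta are
    allowed, which covers the two tails. *)
Lemma noise_tail_signed (a n : nat) (b theta : R) : (1 <= a)%N -> (1 <= n)%N ->
    0 < b -> zeta ^+ 2 * theta ^+ 2 = b / n%:R ->
  (P [set w | (b <= theta * (\sum_(1 <= s < n.+1) noise a s w))%R] <=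
   (expR (- (b / 2)))%:E)%E.
Proof.
move=> a1 n1 b0 htheta.
have n0 : (n%:R : R) != 0 by rewrite pnatr_eq0 -lt0n.
pose g i := if i is Noise _ s then s else 0%N.
have := @chernoff_sources (Noise a) g (noise a) (fun _ y => theta * y)
  (fun=> b / n%:R / 2) (index_iota 1 (1 + n)) (b / 2).
rewrite sum_const_seq.
have -> : n%:R * (b / n%:R / 2) + b / 2 = b by field.
under eq_set => w do rewrite -mulr_sumr.
apply => //.
- exact: iota_uniq.
- by move=> s; rewrite mem_index_iota => /andP[s1 _] /=; rewrite a1 s1.
- by move=> s; exact: measurable_funM.
- move=> s; rewrite mem_index_iota => /andP[s1 _].
  have := noise_subgaussian hmodel theta a1 s1; rewrite htheta.
  rewrite /mmt_gen_fun unlock; apply: le_trans.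
  by under [in leRHS]eq_integral => w _ do rewrite /= mulrC.
Qed.

Lemma measurable_noise_sum a n :
  measurable_fun setT (fun w => \sum_(1 <= s < n.+1) noise a s w).
Proof. by apply: measurable_sum => s. Qed.

Lemma measurable_noise_deviation a n (r : R) :
  measurable [set w | r < `| \sum_(1 <= s < n.+1) noise a s w |].
Proof.
apply: (measurable_set_lt (f := cst r)) => //; apply: measurableT_comp => //.
exact: measurable_noise_sum.
Qed.

(** The radius is chosen so that theta times n times the radius is b when
    theta = sqrt(b/n)/zeta. *)
Lemma noise_tail (a n : nat) (b : R) : (1 <= a)%N -> (1 <= n)%N -> 0 < b ->
  (P [set w | (n%:R * Num.sqrt (zeta ^+ 2 * b / n%:R) <
              `| \sum_(1 <= s < n.+1) noise a s w |)%R] <=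
   (2 * expR (- (b / 2)))%:E)%E.
Proof.
move=> a1 n1 b0.
have n0 : 0 < n%:R :> R by rewrite ltr0n.
pose th := Num.sqrt (b / n%:R) / zeta.
have th0 : 0 < th by rewrite divr_gt0// sqrtr_gt0 divr_gt0.
have bn0 : 0 <= b / n%:R by rewrite divr_ge0 ?ltW.
have hth : zeta ^+ 2 * th ^+ 2 = b / n%:R.
  rewrite /th expr_div_n sqr_sqrtr// mulrCA divff ?mulr1//.
  by rewrite expf_eq0/= gt_eqF.
have hr : th * (n%:R * Num.sqrt (zeta ^+ 2 * b / n%:R)) = b.
  rewrite -mulrA sqrtrM ?sqr_ge0// sqrtr_sqr gtr0_norm// /th.
  rewrite [LHS](_ : _ = n%:R * (Num.sqrt (b / n%:R) ^+ 2) * (zeta / zeta)); last by ring.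
  by rewrite sqr_sqrtr// divff ?gt_eqF// mulr1 mulrCA divff ?mulr1// gt_eqF.
set S := fun w => \sum_(1 <= s < n.+1) noise a s w.
have mS : measurable_fun setT S := measurable_noise_sum a n.
have mle th' : measurable [set w | b <= th' * S w].
  by apply: (measurable_set_le (f := cst b)) => //; exact: measurable_funM.
apply: (@le_trans _ _ (P ([set w | b <= th * S w] `|` [set w | b <= - th * S w]))).
  apply: le_measure; rewrite ?inE.
  - exact: measurable_noise_deviation.
  - exact: measurableU.
  - move=> w /=; rewrite ltr_normr => /orP[] rS; [left|right].
      by rewrite -hr ler_pM2l// ltW.
    by rewrite -hr mulNr -mulrN ler_pM2l// ltW.
apply: (le_trans (measureU2 _ _ _)) => //.
rewrite mulr_natl mulr2n EFinD; apply: leeD; apply: noise_tail_signed => //.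
by rewrite sqrrN.
Qed.

Lemma measurable_no_small_rank (k : nat) (p : R) :
  measurable [set w | forall a, (1 <= a <= k)%N -> p <= gamma a w].
Proof.
rewrite (_ : mkset _ =
  \bigcap_(a in [set a | (1 <= a <= k)%N]) [set w | p <= gamma a w])//.
apply: bigcap_measurableType => a _.
exact: (measurable_set_le (f := cst p)).
Qed.

(** The number of ranks below p has lower-tail exponent k p / 2; here it is zero. *)
Lemma small_rank_tail (k : nat) (p x : R) : 0 <= p <= 1 -> x <= k%:R * (p / 2) ->
  (P [set w | forall a, (1 <= a <= k)%N -> (p <= gamma a w)%R] <= (expR (- x))%:E)%E.
Proof.
move=> p01 xkp.
pose g i := if i is Rank a then a else 0%N.
have := @chernoff_sources Rank g gamma (fun _ y => - \1_`]-oo, p[ y)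
  (fun=> - (p / 2)) (index_iota 1 (1 + k)) x.
have mI : measurable_fun setT (fun y : R => - \1_`]-oo, p[ y : R).
  by apply: measurableT_comp => //; exact: measurable_indic.
move=> H; apply: le_trans (H _ _ _ _ _ _) => //; last 3 first.
- exact: iota_uniq.
- by move=> s; rewrite mem_index_iota => /andP[s1 _].
- move=> a; rewrite mem_index_iota => /andP[a1 _].
  apply: (mgf_opp_indicator (A := gamma a @^-1` `]-oo, p[)) => //.
    by rewrite -[X in measurable X]setTI; exact: measurable_funP.
  rewrite -[X in (_ <= X)%E]/(distribution P (gamma a) `]-oo, p[).
  by rewrite (rank_uniform hmodel)//; exact: uniform_prob_lt_ge.
have m1 (a : nat) : measurable_fun setT (fun w => - \1_`]-oo, p[ (gamma a w) : R).
  exact: (measurableT_comp mI).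
apply: le_measure; rewrite ?inE.
- exact: measurable_no_small_rank.
- by apply: measurable_set_le => //; exact: measurable_sum.
- move=> w /= H'; rewrite sum_const_seq [leRHS]big_seq big1; first by rewrite mulrN; lra.
  move=> a; rewrite mem_index_iota add1n ltnS => /H' pa.
  by rewrite indicE memNset ?oppr0//= in_itv/= ltNge pa.
Qed.

Lemma measurable_window_count (t0 n : nat) (u : nat -> R) (q x : R) :
  measurable [set w |
    \sum_(t0.+1 <= s < t0.+1 + n) \1_`[u s, u s + q] (U s w) <= x].
Proof.
apply: (measurable_set_le (g := cst x)) => //; apply: measurable_sum => s.
have mI : measurable_fun setT (\1_`[u s, u s + q] : R -> R).
  exact: measurable_indic.
exact: (measurableT_comp mI).
Qed.

Lemma window_tail (t0 n : nat) (u : nat -> R) (q x : R) :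
    (forall s, (t0 < s <= t0 + n)%N -> 0 <= u s) ->
    (forall s, (t0 < s <= t0 + n)%N -> u s + q <= 1) ->
  (P [set w | (\sum_(t0.+1 <= s < t0.+1 + n) \1_`[u s, u s + q] (U s w) <=
               n%:R * (q / 2) - x)%R] <= (expR (- x))%:E)%E.
Proof.
move=> u0 u1.
pose g i := if i is Scope a then a else 0%N.
have := @chernoff_sources Scope g U (fun s y => - \1_`[u s, u s + q] y)
  (fun=> - (q / 2)) (index_iota t0.+1 (t0.+1 + n)) x.
have mI s : measurable_fun setT (fun y : R => - \1_`[u s, u s + q] y : R).
  by apply: measurableT_comp => //; exact: measurable_indic.
rewrite sum_const_seq; under eq_set => w.
  rewrite sumrN lerNr opprD mulrN opprK; over.
apply => //.
- exact: iota_uniq.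
- by move=> s; rewrite mem_index_iota => /andP[s1 _] /=; exact: leq_trans s1.
- move=> s; rewrite mem_index_iota addSn ltnS => s01.
  apply: (mgf_opp_indicator (A := U s @^-1` `[u s, u s + q])) => //.
    by rewrite -[X in measurable X]setTI; exact: measurable_funP.
  rewrite -[X in (_ <= X)%E]/(distribution P (U s) `[u s, u s + q]).
  rewrite (scope_uniform hmodel)//; last first.
    by case/andP: s01 => + _; exact: leq_trans.
  rewrite [X in (X%:E <= _)%E](_ : _ = u s + q - u s); last by ring.
  by apply: uniform_prob_itv_ge; [exact: u0|exact: u1].
Qed.

(** If y lies between 2^i p and 2^(i+1) p, the term i alone is large enough.  The
    number of scales plays the role of the logarithm given by the integral of
    1/y. *)
Lemma dyadic_bound (p y : R) (J : nat) : 0 < p -> (0 < J)%N -> y < 2 ^+ J * p ->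
  p / Num.max p y <= \sum_(j < J) 2 ^- j * \1_`]-oo, (2 ^+ j.+1 * p)[ y.
Proof.
move=> p0; case: J => // J _; elim: J => [|J IH] yJ.
  rewrite big_ord1 expr0 invr1 mul1r indicE mem_set/=; last by rewrite in_itv.
  by rewrite ler_pdivrMr ?lt_max ?p0// mul1r le_max lexx.
rewrite big_ord_recr/=; have [yl|ly] := ltP y (2 ^+ J.+1 * p).
  by apply: (le_trans (IH yl)); rewrite lerDl mulr_ge0// indicE.
apply: (@le_trans _ _ (2 ^- J.+1)).
  rewrite ler_pdivrMr ?lt_max ?p0// -ler_pdivrMl ?invr_gt0 ?exprn_gt0// invrK.
  by rewrite le_max ly orbT.
rewrite [\1_`]-oo, (2 ^+ J.+2 * p)[ y]indicE mem_set/=; last by rewrite in_itv.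
rewrite mulr1 lerDr; apply: sumr_ge0 => j _.
by rewrite mulr_ge0// indicE.
Qed.

Lemma measurable_truncated_inverse (p : R) : 0 < p ->
  measurable_fun setT (fun y : R => p / Num.max p y).
Proof.
move=> p0; have mx0 (y : R) : 0 < Num.max p y by rewrite lt_max p0.
apply: nonincreasing_measurable => // y z yz.
rewrite ler_pM2l// lef_pV2 ?posrE//.
by rewrite ge_max le_max lexx/= le_max yz orbT.
Qed.

Lemma measurable_inverse_rank_sum (m : nat) (p x : R) : 0 < p ->
  measurable [set w | x <= \sum_(1 <= a < 1 + m) p / Num.max p (gamma a w) / 2].
Proof.
move=> p0; apply: (measurable_set_le (f := cst x)) => //.
apply: measurable_sum => a; apply: measurable_funM => //.
exact: (measurableT_comp (measurable_truncated_inverse p0)).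
Qed.

(** The scale j has weight 2^-j and probability at most 2^(j+1) p, so each of the
    J scales contributes 2 p to the expectation. *)
Lemma inverse_rank_tail (m J : nat) (p x : R) : 0 < p -> (0 < J)%N ->
    1 < 2 ^+ J * p ->
  (P [set w | (m%:R * (2 * J%:R * p) + x <=
        \sum_(1 <= a < 1 + m) p / Num.max p (gamma a w) / 2)%R] <=
   (expR (- x))%:E)%E.
Proof.
move=> p0 J0 Jp.
pose g i := if i is Rank a then a else 0%N.
have := @chernoff_sources Rank g gamma (fun _ y => p / Num.max p y / 2)
  (fun=> 2 * J%:R * p) (index_iota 1 (1 + m)) x.
rewrite sum_const_seq.
have mx0 (y : R) : 0 < Num.max p y by rewrite lt_max p0.
have mV := measurable_truncated_inverse p0.
apply => //.
- exact: iota_uniq.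
- by move=> s; rewrite mem_index_iota => /andP[s1 _].
- by move=> _; exact: measurable_funM.
- move=> a; rewrite mem_index_iota => /andP[a1 _].
  have -> : 2 * J%:R * p = \sum_(j < J) 2 ^- j * (2 ^+ j.+1 * p).
    rewrite (eq_bigr (fun=> 2 * p)); last first.
      move=> j _; have h : (2 ^+ j : R) != 0 by rewrite expf_neq0.
      by rewrite exprS; field.
    by rewrite sumr_const card_ord -[RHS]mulr_natl; ring.
  apply: (mgf_half_le (b := fun j => 2 ^- j)
    (A := fun j => gamma a @^-1` `]-oo, (2 ^+ j.+1 * p)[)
    (m := fun j => 2 ^+ j.+1 * p) (Y := fun w => p / Num.max p (gamma a w))).
  + exact: (measurableT_comp mV).
  + move=> w; rewrite divr_ge0 ?(ltW p0) ?(ltW (mx0 _))//=.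
    by rewrite ler_pdivrMr// mul1r le_max lexx.
  + by move=> j; rewrite -[X in measurable X]setTI; exact: measurable_funP.
  + by [].
  + move=> w; apply: dyadic_bound => //.
    by have /andP[_ g1] := rank_range hmodel w a1; exact: le_lt_trans Jp.
  + move=> j; rewrite -[X in (X <= _)%E]/(distribution P (gamma a) `]-oo, (2 ^+ j.+1 * p)[).
    rewrite (rank_uniform hmodel)//.
    by apply: uniform_prob_lt; rewrite mulr_ge0// ltW.
Qed.

End tails.

(** * The mean reward as a function of the rank *)

Section mean_curve.
Context (R : realType) (lam : R -> R).
Hypothesis hlam : quantile_function lam.
Hypothesis hlambda0 : (lambda0 lam < +oo)%E.

(** By monotonicity the limit at 0 is a supremum; this gives at once that it
    dominates all the values and that values close to it are attained. *)
Lemma lambda0E :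
  lambda0 lam = ereal_sup [set (lam x)%:E | x in `]0, 1]].
Proof.
apply: cvg_lim => //.
apply: (@nonincreasing_at_right_cvge _ _ _ (BRight 1)) => [|x y].
  by rewrite bnd_simp.
rewrite !in_itv/= => /andP[x0 x1] /andP[y0 y1] xy.
by rewrite lee_fin hlam.1.
Qed.

Lemma lam_le_lambda0 x : 0 < x <= 1 -> ((lam x)%:E <= lambda0 lam)%E.
Proof.
by move=> x01; rewrite lambda0E; apply: ereal_sup_ubound; exists x => //=; rewrite in_itv.
Qed.

Lemma lambda0_fin_num : lambda0 lam \is a fin_num.
Proof.
rewrite fin_numElt hlambda0 andbT.
by apply: (lt_le_trans (ltNyr (lam 1))); apply: lam_le_lambda0; rewrite ltr01 lexx.
Qed.

Definition mean (x : R) : R := fine (lambda lam x).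
Definition gap (x : R) : R := fine (lambda0 lam) - mean x.

Lemma lambda_mean x : lambda lam x = (mean x)%:E.
Proof.
by rewrite /mean /lambda; case: ifP => // _; rewrite fineK// lambda0_fin_num.
Qed.

Lemma Delta_gap x : Delta lam x = (gap x)%:E.
Proof.
by rewrite /Delta lambda_mean -(fineK lambda0_fin_num) -EFinB.
Qed.

Lemma mean_nonincreasing x y : 0 <= x -> x <= y -> y <= 1 -> mean y <= mean x.
Proof.
move=> x0 xy y1; rewrite -lee_fin -!lambda_mean /lambda.
have [y0|y0] := eqVneq y 0.
  have -> : x = 0 by apply/le_anti; rewrite x0 andbT -y0.
  by rewrite eqxx.
have [_|xn0] := eqVneq x 0; first by apply: lam_le_lambda0; rewrite y1 andbT lt_neqAle eq_sym y0 (le_trans x0).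
by rewrite lee_fin hlam.1// lt_neqAle eq_sym xn0.
Qed.

Lemma gap_nondecreasing x y : 0 <= x -> x <= y -> y <= 1 -> gap x <= gap y.
Proof. by move=> x0 xy y1; rewrite lerB// mean_nonincreasing. Qed.

Lemma gap0 : gap 0 = 0.
Proof. by rewrite /gap /mean /lambda eqxx subrr. Qed.

Lemma gap_ge0 x : 0 <= x <= 1 -> 0 <= gap x.
Proof. by move=> /andP[x0 x1]; rewrite -gap0 gap_nondecreasing. Qed.

Let S e : set R := [set eta | 0 <= eta <= 1 /\ (Delta lam eta <= e%:E)%E].

Lemma gap_le_scope_fraction e x : 0 <= x <= 1 -> gap x <= e ->
  x <= scope_fraction lam e.
Proof.
move=> x01 xe; apply: (ub_le_sup (E := S e)).
  by exists 1 => y [/andP[]].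
by split => //; rewrite Delta_gap lee_fin.
Qed.

Lemma scope_fraction_ge0 e : 0 <= e -> 0 <= scope_fraction lam e.
Proof.
by move=> e0; apply: gap_le_scope_fraction; rewrite ?gap0// lexx ler01.
Qed.

Lemma lt_scope_fraction_gap e x : 0 <= e -> 0 <= x -> x < scope_fraction lam e ->
  gap x <= e.
Proof.
move=> e0 x0 xg; have S0 : S e !=set0.
  by exists 0; split; rewrite ?lexx ?ler01// Delta_gap gap0 lee_fin.
have [y [/andP[y0 y1]]] := sup_gt S0 xg.
rewrite Delta_gap lee_fin => ye xy.
by apply: le_trans ye; rewrite gap_nondecreasing// ltW.
Qed.

Lemma scope_fraction_le1 e : 0 <= e -> scope_fraction lam e <= 1.
Proof.
move=> e0; apply: ge_sup => [|y [/andP[]]//].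
by exists 0; split; rewrite ?lexx ?ler01// Delta_gap gap0 lee_fin.
Qed.

Lemma scope_fraction_gt0 e : 0 < e -> 0 < scope_fraction lam e.
Proof.
move=> e0; have := lambda0_fin_num; rewrite lambda0E => fn.
have [_ [x /= + <-]] := ub_ereal_sup_adherent e0 fn.
rewrite in_itv/= => x01 + ; rewrite -lambda0E -(fineK lambda0_fin_num) -EFinB lte_fin => xe.
have /andP[x0 x1] := x01.
apply: (lt_le_trans x0); apply: gap_le_scope_fraction; first by rewrite ltW.
by rewrite /gap /mean /lambda gt_eqF//= lerBlDr -lerBlDl ltW.
Qed.

Lemma scope_fraction_nondecreasing e e' : 0 <= e -> e <= e' ->
  scope_fraction lam e <= scope_fraction lam e'.
Proof.
move=> e0 ee'; apply: ge_sup => [|y [y01]].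
  by exists 0; split; rewrite ?lexx ?ler01// Delta_gap gap0 lee_fin.
rewrite Delta_gap lee_fin => ye; apply: gap_le_scope_fraction => //.
exact: le_trans ee'.
Qed.

Variables (zeta e : R).
Hypothesis zeta_gt0 : 0 < zeta.
Hypothesis e_gt0 : 0 < e.

(** The sample complexity enters the proof only through these two real
    inequalities.  A vanishing gap would make the sample complexity infinite,
    which the finite t excludes. *)
Lemma complexity_cond (c t : R) : 0 < c ->
    (c%:E * complexity lam zeta e <= t%:E)%E ->
  c <= t * scope_fraction lam (e / 2) /\
  forall x, scope_fraction lam e <= x -> x <= 1 ->
    c * (zeta ^+ 2 * x) <= t * (scope_fraction lam (e / 2) * gap x ^+ 2).
Proof.
move=> c0; have g0 : 0 < scope_fraction lam (e / 2).
  by apply: scope_fraction_gt0; rewrite divr_gt0.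
have ge0 := scope_fraction_gt0 e_gt0.
rewrite /complexity; set g := scope_fraction lam (e / 2) in g0 *.
set s := ereal_sup _; rewrite -lee_pdivlMl// ge_max => /andP[].
rewrite inver gt_eqF// -EFinM lee_fin => gt st; split.
  by move: gt; rewrite ler_pdivlMl// ler_pdivrMr.
move=> x gx x1.
have xs : ((zeta ^+ 2 * x)%:E / (g%:E * Delta lam x ^+ 2) <= s)%E.
  by apply: ereal_sup_ubound; exists x => //=; rewrite gx x1.
have := le_trans xs st; rewrite Delta_gap -EFin_expe -EFinM inver.
have zx0 : 0 < zeta ^+ 2 * x by rewrite mulr_gt0 ?exprn_gt0// (lt_le_trans ge0).
case: eqP => [_|/eqP gn0].
  by rewrite mulry gtr0_sg// mul1e leye_eq.
rewrite -!EFinM lee_fin.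
have gg0 : 0 < g * gap x ^+ 2.
  by rewrite lt_neqAle eq_sym gn0 mulr_ge0 ?sqr_ge0// ltW.
by rewrite ler_pdivlMl// [c * (_ / _)]mulrA ler_pdivrMr.
Qed.

End mean_curve.

(** * Elementary inequalities *)

Section numerics.
Context (R : realType).

Lemma expR_half_le2 : expR (1 / 2) <= 2 :> R.
Proof.
rewrite -[leLHS]invrK -expRN invf_ple ?posrE ?expR_gt0//.
by have := @expR_ge1Dx R (- (1 / 2)); lra.
Qed.

Lemma expR_lt_exp2 (L : R) (J : nat) : 2 * L < J%:R -> expR L < 2 ^+ J.
Proof.
move=> LJ; apply: (@lt_le_trans _ _ (expR (J%:R * (1 / 2)))).
  by rewrite ltr_expR; lra.
by rewrite expRM_natl lerXn2r ?nnegrE ?expR_ge0// expR_half_le2.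
Qed.

(** The last hypothesis compares the lower and upper bounds on the number of
    times with a scope of the right size.  In terms of r = t / psi, the left-hand
    side is at least r 2^27 L^3 up to the term 2 L, and the right-hand side is
    at most a constant times r L^3. *)
Lemma few_pulls_absurd (L p t psi k J S : R) :
    1 <= L -> 0 < p -> p <= 1 -> 2 ^+ 30 * L ^+ 4 <= psi -> 4 * psi <= t * p ->
    0 <= k -> k * p <= 5 * L -> 0 <= J -> J <= 3 * L ->
    S / 2 <= 2 * k * (2 * J * p) + 2 * L ->
    t / 2 * (1 / (2 * L) / 2) - 2 * L < 2 * k + 16 * t * (6 * L) / psi * S ->
  False.
Proof.
move=> L1 p0 p1 + ht k0 kp J0 J3 hS.
rewrite (exprD 2 3 27) => hpsi.
(* The power is kept abstract: only its comparison with the final constant matters. *)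
have M0 : 128 * 128 <= 2 ^+ 27 :> R.
  apply: (@le_trans _ _ (2 ^+ 14)); last by rewrite ler_eXn2l// ltr1n.
  by rewrite -natrM -natrX ler_nat.
set M : R := 2 ^+ 27 in M0 hpsi.
have {}hpsi : 8 * M * L ^+ 4 <= psi.
  by apply: le_trans hpsi; rewrite !exprS expr0; lra.
have M1 : 0 < M by lra.
have L0 : 0 < L by lra.
have psi0 : 0 < psi by apply: lt_le_trans hpsi; rewrite !mulr_gt0 ?exprn_gt0.
pose r := t / psi.
have tr : t = r * psi by rewrite /r divfK// gt_eqF.
have rp : 4 <= r * p by rewrite /r mulrAC ler_pdivlMr.
have r0 : 0 < r by nra.
have r4 : 4 <= r by nra.
have kr : 4 * k <= 5 * L * r.
  have h1 : 4 * k <= k * (r * p) by nra.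
  apply: (le_trans h1); rewrite mulrCA mulrC ler_pM2r//.
have kJ : k * p * J <= 15 * L ^+ 2.
  apply: (@le_trans _ _ (5 * L * (3 * L))); last by rewrite expr2; lra.
  by apply: ler_pM => //; rewrite mulr_ge0// ltW.
have L12 : L <= L ^+ 2 by rewrite expr2; nra.
have S124 : S <= 124 * L ^+ 2.
  by move: hS kJ; rewrite (_ : 2 * k * (2 * J * p) = 4 * (k * p * J)); [lra|ring].
have -> : 16 * t * (6 * L) / psi * S = 96 * r * L * S.
  by rewrite /r; field; rewrite gt_eqF.
have -> : t / 2 * (1 / (2 * L) / 2) = t / (8 * L) by field; rewrite gt_eqF.
have L3 : L ^+ 3 = L * L ^+ 2 by rewrite exprS.
have L13 : L <= L ^+ 3.
  by rewrite L3 ler_peMr ?(ltW L0)//; lra.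
have tl : r * (M * L ^+ 3) <= t / (8 * L).
  rewrite ler_pdivlMr ?mulr_gt0// tr.
  rewrite [leLHS](_ : _ = r * (8 * M * L ^+ 4)); last by ring.
  by rewrite ler_pM2l.
have h2 : 96 * r * L * S <= r * (96 * 124 * L ^+ 3).
  rewrite [leRHS](_ : _ = 96 * r * L * (124 * L ^+ 2)); last by ring.
  by rewrite ler_pM2l// mulr_gt0// mulr_gt0.
have h3 : 2 * L + 2 * k <= r * (3 * L ^+ 3).
  have : 2 * L <= r * (L / 2) by nra.
  have : 2 * k <= r * (5 / 2 * L) by lra.
  have : r * L <= r * L ^+ 3 by rewrite ler_pM2l.
  lra.
have h4 : 0 < r * L ^+ 3 by rewrite mulr_gt0 ?exprn_gt0.
have h5 : 128 * 128 * (r * L ^+ 3) <= r * (M * L ^+ 3).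
  by rewrite [r * (M * _)]mulrCA ler_pM2r.
lra.
Qed.

End numerics.

(** * Pull counts when the recommendation is bad *)

Section run.
Context (R : realType) (T : Type) (lam : R -> R) (zeta delta : R)
  (gamma : nat -> T -> R) (noise : nat -> nat -> T -> R) (U : nat -> T -> R)
  (hata hatr : nat -> T -> nat) (w : T).
Hypothesis hlam : quantile_function lam.
Hypothesis hlambda0 : (lambda0 lam < +oo)%E.
Hypothesis hzeta : 0 < zeta.
Hypothesis hdelta : 0 < delta < 1.

Definition log_level (t : nat) : R := ln (5 * t%:R / delta).
Definition beta (t : nat) : R := 6 * log_level t.

Lemma log_level_arg t : (1 <= t)%N -> 0 < 5 * t%:R / delta.
Proof.
by move=> t1; case/andP: hdelta => d0 _; rewrite divr_gt0// mulr_gt0 ?ltr0n.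
Qed.

Lemma log_level_le s t : (1 <= s)%N -> (s <= t)%N -> log_level s <= log_level t.
Proof.
move=> s1 st; case/andP: hdelta => d0 _.
rewrite ler_ln ?posrE ?log_level_arg//; last exact: leq_trans st.
by rewrite ler_pM2r ?invr_gt0// ler_pM2l// ler_nat.
Qed.

Lemma log_level_ge1 t : (1 <= t)%N -> 1 <= log_level t.
Proof.
move=> t1; case/andP: hdelta => d0 d1.
rewrite -ler_expR lnK ?posrE ?log_level_arg//.
have e3 : expR 1 <= 5 :> R.
  have h2 := expR_half_le2 R.
  have -> : 1 = 1 / 2 + 1 / 2 :> R by field.
  by rewrite expRD; have := expR_gt0 (1 / 2 : R); nra.
apply: (le_trans e3); rewrite ler_pdivlMr//.
have : 1 <= t%:R :> R by rewrite ler1n.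
nra.
Qed.

Let X := reward lam gamma noise.
Let m a := mean lam (gamma a w).
Let rad (t n : nat) : R := Num.sqrt (zeta ^+ 2 * beta t / n%:R).

Hypothesis rank01 : forall a, (1 <= a)%N -> 0 <= gamma a w <= 1.
Hypothesis scope01 : forall t, (1 <= t)%N -> 0 < U t w < 1.
Hypothesis concentration : forall a n, (1 <= a)%N -> (1 <= n)%N ->
  `| \sum_(1 <= s < n.+1) noise a s w | <=
  n%:R * Num.sqrt (zeta ^+ 2 * beta (maxn a n) / n%:R).
Hypothesis pullP : forall t, (1 <= t)%N ->
  is_argmax [set a | (1 <= a <= scope_size U t w)%N]
    (fun a => UCB X hata zeta beta a t.-1 w) (hata t w).
Hypothesis recommendP : forall t, (1 <= t)%N ->
  is_argmax [set a | (1 <= a)%N]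
    (fun a => LCB X hata zeta beta a t w) (hatr t w).

Lemma pulls_recr a t :
  pulls hata a t.+1 w = (pulls hata a t w + (hata t.+1 w == a))%N.
Proof. by rewrite /pulls big_nat_recr. Qed.

Lemma pulls_0 a : pulls hata a 0 w = 0%N.
Proof. by rewrite /pulls big_geq. Qed.

Lemma pulls_le a s t : (s <= t)%N -> (pulls hata a s w <= pulls hata a t w)%N.
Proof.
elim: t => [|t IH]; first by rewrite leqn0 => /eqP ->.
rewrite leq_eqVlt ltnS => /orP[/eqP -> //|/IH h].
by apply: (leq_trans h); rewrite pulls_recr leq_addr.
Qed.

Lemma pulls_le_time a t : (pulls hata a t w <= t)%N.
Proof.
elim: t => [|t IH]; first by rewrite pulls_0.
by rewrite pulls_recr -addn1 leq_add// leq_b1.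
Qed.

Lemma scope_size_le t : (1 <= t)%N -> (scope_size U t w <= t)%N.
Proof.
move=> t1; have /andP[u0 u1] := scope01 t1.
rewrite /scope_size -[leqRHS](@natrK R).
apply: le_truncn; rewrite -[leRHS]powRr1 ?ler0n//.
by apply: ler_powR; rewrite ?ler1n// ltW.
Qed.

Lemma pulled_le_time a t : (0 < pulls hata a t w)%N -> (1 <= a <= t)%N.
Proof.
elim: t => [|t IH]; first by rewrite pulls_0.
rewrite pulls_recr; have [<- _|_] := eqVneq (hata t.+1 w) a.
  have [/= /andP[-> h] _] := pullP (ltn0Sn t).
  exact/(leq_trans h)/scope_size_le.
by rewrite addn0 => /IH /andP[-> /leqW].
Qed.

(** Confidence radii grow with time and shrink with the pull count, so a radius
    from an earlier round can be compared with the one of the time of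
    recommendation. *)
Lemma rad_le s t n n' : (1 <= s)%N -> (s <= t)%N -> (1 <= n)%N -> (n <= n')%N ->
  rad s n' <= rad t n.
Proof.
move=> s1 st n1 nn'; have n0 : (0 < n')%N by exact: leq_trans nn'.
have bs : 0 <= beta s.
  by rewrite mulr_ge0// (le_trans ler01)// log_level_ge1.
have bt : beta s <= beta t by rewrite ler_pM2l// log_level_le.
rewrite /rad ler_wsqrtr//; apply: ler_pM.
- by rewrite mulr_ge0 ?sqr_ge0.
- by rewrite invr_ge0.
- by rewrite ler_pM2l ?exprn_gt0.
- by rewrite lef_pV2 ?posrE ?ltr0n// ler_nat.
Qed.

Lemma empirical_mean_close a t : (0 < pulls hata a t w)%N ->
  `| empirical_mean X hata a t w - m a | <= rad t (pulls hata a t w).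
Proof.
move=> N0; have /andP[a1 at_] := pulled_le_time N0.
set N := pulls hata a t w in N0 *.
have Npos : 0 < N%:R :> R by rewrite ltr0n.
have -> : empirical_mean X hata a t w - m a =
    (\sum_(1 <= s < N.+1) noise a s w) / N%:R.
  rewrite /empirical_mean -/N.
  have -> : \sum_(1 <= s < N.+1) X a s w =
      N%:R * m a + \sum_(1 <= s < N.+1) noise a s w.
    by rewrite big_split/= -(sum_const_seq 1 N).
  by field; rewrite gt_eqF.
rewrite normrM (gtr0_norm (x := N%:R^-1)) ?invr_gt0// ler_pdivrMr//.
apply: (le_trans (concentration a1 N0)); rewrite mulrC ler_pM2r//.
apply: rad_le => //; first by rewrite leq_max a1.
by rewrite geq_max at_ pulls_le_time.
Qed.

Lemma mean_le_UCB a t : (1 <= a)%N -> ((m a)%:E <= UCB X hata zeta beta a t w)%E.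
Proof.
move=> a1; rewrite /UCB; case: eqP => [_|/eqP]; first exact: leey.
rewrite -lt0n => N0; rewrite lee_fin -/(rad _ _).
by have := empirical_mean_close N0; rewrite ler_norml => /andP[]; lra.
Qed.

Lemma UCB_le a t : (0 < pulls hata a t w)%N ->
  (UCB X hata zeta beta a t w <= (m a + 2 * rad t (pulls hata a t w))%:E)%E.
Proof.
move=> N0; rewrite /UCB eqn0Ngt N0/= lee_fin -/(rad _ _).
by have := empirical_mean_close N0; rewrite ler_norml => /andP[]; lra.
Qed.

Lemma LCB_le_mean a t : (LCB X hata zeta beta a t w <= (m a)%:E)%E.
Proof.
rewrite /LCB; case: eqP => [_|/eqP]; first exact: leNye.
rewrite -lt0n => N0; rewrite lee_fin -/(rad _ _).
by have := empirical_mean_close N0; rewrite ler_norml => /andP[]; lra.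
Qed.

Lemma LCB_ge a t : (0 < pulls hata a t w)%N ->
  ((m a - 2 * rad t (pulls hata a t w))%:E <= LCB X hata zeta beta a t w)%E.
Proof.
move=> N0; rewrite /LCB eqn0Ngt N0/= lee_fin -/(rad _ _).
by have := empirical_mean_close N0; rewrite ler_norml => /andP[]; lra.
Qed.

Variable epsilon : R.
Hypothesis hepsilon : 0 < epsilon.

Let g := scope_fraction lam epsilon.
Let gap_of a := gap lam (gamma a w).

(** The UCB rule bounds the gap of the pulled arm through the good arm b, and the
    LCB rule bounds the gap of the recommended arm through the pulled arm.  If
    the pulled arm has gap above epsilon, the maximum is its own rank and the
    first bound suffices.  Otherwise the maximum is g, and the gap there is at
    most that of the recommended arm, whose rank is at least g. *)
Lemma gap_pulled_le t s b : (1 <= t)%N -> epsilon < gap_of (hatr t w) ->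
    (1 <= s <= t)%N -> (1 <= b <= scope_size U s w)%N ->
    gap_of b <= epsilon / 2 -> (0 < pulls hata (hata s w) s.-1 w)%N ->
  gap lam (Num.max g (gamma (hata s w) w)) <=
  8 * rad t (pulls hata (hata s w) s.-1 w).
Proof.
move=> t1 bad /andP[s1 st] /andP[b1 bs] good.
set a := hata s w; set n := pulls hata a s.-1 w => n0.
have st' : (s.-1 <= t)%N by rewrite (leq_trans (leq_pred _)).
have s10 : (1 <= s.-1)%N by exact: leq_trans (pulls_le_time a s.-1).
have a1 : (1 <= a)%N by have /andP[] := pulled_le_time n0.
set rho := rad t n.
have rho1 : rad s.-1 n <= rho by apply: rad_le.
have rho2 : rad t (pulls hata a t w) <= rho by apply: rad_le => //; exact: pulls_le.
have ga : gap_of a <= epsilon / 2 + 2 * rho.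
  have [_ /(_ b)] := pullP s1; rewrite /= b1 bs => /(_ isT) ub.
  have := le_trans (mean_le_UCB s.-1 b1) (le_trans ub (UCB_le n0)).
  rewrite lee_fin -/n; move: good; rewrite /gap_of /gap -/(m b) -/(m a); lra.
(* The arm r maximizes the LCB, so its mean is at least the LCB of a. *)
have gr : gap_of (hatr t w) <= gap_of a + 2 * rho.
  have [_ /(_ a a1)] := recommendP t1 => lb.
  have N0 : (0 < pulls hata a t w)%N by apply: leq_trans (pulls_le _ st').
  have := le_trans (LCB_ge N0) (le_trans lb (LCB_le_mean _ _)).
  rewrite lee_fin /gap_of /gap -/(m (hatr t w)) -/(m a); move: rho2; lra.
have r1 : (1 <= hatr t w)%N by have [] := recommendP t1.
have /andP[r0 r1'] := rank01 r1; have /andP[a0 a1'] := rank01 a1.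
(* In both cases gap_of (hatr t w) > epsilon or gap_of a > epsilon absorbs epsilon / 2. *)
have [agood|abad] := leP (gap_of a) epsilon.
- have ag : gamma a w <= g by apply: gap_le_scope_fraction => //; rewrite a0.
  rewrite max_l//; apply: (@le_trans _ _ (gap_of (hatr t w))); last by lra.
  apply: gap_nondecreasing => //; first by apply: scope_fraction_ge0 => //; exact: ltW.
  rewrite leNgt; apply/negP => /lt_scope_fraction_gap h.
  by have := h hlam hlambda0 (ltW hepsilon) r0; rewrite leNgt bad.
- rewrite max_r; first by rewrite -/(gap_of a) -/rho; move: ga abad hepsilon; lra.
  rewrite leNgt; apply/negP => /lt_scope_fraction_gap h.
  by have := h hlam hlambda0 (ltW hepsilon) a0; rewrite leNgt abad.
Qed.

Variable (psi : R).
Hypothesis psi_gt0 : 0 < psi.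

Let g' := scope_fraction lam (epsilon / 2).

Lemma pulls_scope_le t s b : (1 <= t)%N ->
    ((4 * psi)%:E * complexity lam zeta epsilon <= t%:R%:E)%E ->
    epsilon < gap_of (hatr t w) ->
    (1 <= s <= t)%N -> (1 <= b <= scope_size U s w)%N ->
    gap_of b <= epsilon / 2 ->
  (pulls hata (hata s w) s.-1 w)%:R <=
  16 * t%:R * beta t / psi * (g' / Num.max g' (gamma (hata s w) w)).
Proof.
move=> t1 cond bad st bs good.
set a := hata s w; set n := pulls hata a s.-1 w.
have bt : 0 < beta t by rewrite mulr_gt0// (lt_le_trans ltr01)// log_level_ge1.
have t0 : 0 < t%:R :> R by rewrite ltr0n.
have g'0 : 0 < g' by apply: scope_fraction_gt0 => //; rewrite divr_gt0.
have mx0 : 0 < Num.max g' (gamma a w) by rewrite lt_max g'0.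
have K0 : 0 < 16 * t%:R * beta t / psi.
  by apply: divr_gt0 => //; apply: mulr_gt0 => //; apply: mulr_gt0.
have [n0|n0] := posnP n.
  by rewrite n0; exact: (mulr_ge0 (ltW K0) (divr_ge0 (ltW g'0) (ltW mx0))).
have := gap_pulled_le t1 bad st bs good n0; rewrite -/a -/n.
set v := Num.max g (gamma a w) => gv.
have /andP[a1 _] := pulled_le_time n0.
have /andP[a0 a1'] := rank01 a1.
have gle1 : g <= 1 by apply: scope_fraction_le1 => //; exact: ltW.
have v01 : 0 <= v <= 1 by rewrite le_max a0 orbT ge_max gle1 a1'.
have g'g : g' <= g.
  have e0 : 0 <= epsilon / 2 by move: hepsilon; lra.
  have e1 : epsilon / 2 <= epsilon by move: hepsilon; lra.
  exact: scope_fraction_nondecreasing.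
have mv : Num.max g' (gamma a w) <= v.
  by rewrite ge_max !le_max g'g lexx/= orbT.
have v0 : 0 < v by exact: lt_le_trans mv.
have [_ /(_ v)] := complexity_cond hlam hlambda0 hzeta hepsilon (mulr_gt0 (ltr0Sn _ 3) psi_gt0) cond.
rewrite -/g -/g'; set D := gap lam v in gv *.
have D0 : 0 <= D by exact: gap_ge0.
have -> : g <= v by rewrite le_max lexx.
have -> : v <= 1 by case/andP: v01.
move=> /(_ isT isT) hD.
have nD : n%:R * D ^+ 2 <= 64 * (zeta ^+ 2 * beta t).
  have n0' : 0 < n%:R :> R by rewrite ltr0n.
  have : D ^+ 2 <= (8 * rad t n) ^+ 2 by rewrite lerXn2r// nnegrE mulr_ge0// sqrtr_ge0.
  rewrite exprMn sqr_sqrtr; last by rewrite divr_ge0 ?ltW// mulr_gt0// exprn_gt0.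
  rewrite -(ler_pM2l n0') => /le_trans; apply.
  rewrite [leLHS](_ : _ = 8 ^+ 2 * (zeta ^+ 2 * beta t) * (n%:R / n%:R)); last by ring.
  rewrite divff ?gt_eqF// mulr1 ler_pM2r; first by lra.
  by rewrite mulr_gt0// exprn_gt0.
apply: (@le_trans _ _ (16 * t%:R * beta t / psi * (g' / v))); last first.
  by rewrite ler_pM2l// ler_pM2l// lef_pV2 ?posrE.
rewrite [leRHS](_ : _ = 16 * t%:R * beta t * g' / (psi * v)); last by field; rewrite !gt_eqF.
rewrite ler_pdivlMr ?mulr_gt0//.
have z2 : 0 < 4 * zeta ^+ 2 by rewrite mulr_gt0// exprn_gt0.
rewrite -(ler_pM2l z2).
apply: (@le_trans _ _ (n%:R * (t%:R * (g' * D ^+ 2)))).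
  rewrite [leLHS](_ : _ = n%:R * (4 * psi * (zeta ^+ 2 * v))); last by ring.
  by rewrite ler_wpM2l.
rewrite [leLHS](_ : _ = t%:R * g' * (n%:R * D ^+ 2)); last by ring.
rewrite [leRHS](_ : _ = t%:R * g' * (64 * (zeta ^+ 2 * beta t))); last by ring.
by rewrite ler_pM2l// mulr_gt0.
Qed.

(** At the last time counted, the count is at most one plus the number of earlier
    pulls. *)
Lemma count_pulls_le a t (Q : pred nat) (B : R) : 0 <= B ->
    (forall s, (1 <= s <= t)%N -> hata s w = a -> Q s ->
      (pulls hata a s.-1 w)%:R <= B) ->
  \sum_(1 <= s < t.+1) ((hata s w == a) && Q s)%:R <= 1 + B.
Proof.
move=> B0.
have le_pulls u : \sum_(1 <= s < u.+1) ((hata s w == a) && Q s)%:R <=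
    (pulls hata a u w)%:R :> R.
  rewrite /pulls natr_sum; apply: ler_sum => s _.
  by rewrite ler_nat; case: (hata s w == a) => //=; case: (Q s).
elim: t => [|t IH] H; first by rewrite big_geq// addr_ge0.
rewrite big_nat_recr//=; have [/andP[/eqP sa Qs]|_] := boolP (_ && _).
  rewrite addrC lerD2l; apply: (le_trans (le_pulls t)).
  by apply: (H t.+1); rewrite ?leqnn.
rewrite addr0; apply: IH => s /andP[s1 st]; apply: H.
by rewrite s1 leqW.
Qed.

(** At each time counted, the pulled arm is among the first 2k, so the count splits
    over these arms. *)
Lemma scope_window_le t k b : (1 <= t)%N ->
    ((4 * psi)%:E * complexity lam zeta epsilon <= t%:R%:E)%E ->
    epsilon < gap_of (hatr t w) ->
    (1 <= b <= k)%N -> gap_of b <= epsilon / 2 ->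
  \sum_(1 <= s < t.+1) (k <= scope_size U s w <= k.*2)%N%:R <=
  k.*2%:R + 16 * t%:R * beta t / psi *
    \sum_(1 <= a < 1 + k.*2) g' / Num.max g' (gamma a w).
Proof.
move=> t1 cond bad /andP[b1 bk] good.
set Q := fun s => (k <= scope_size U s w <= k.*2)%N.
set K := 16 * t%:R * beta t / psi.
have K0 : 0 <= K.
  have bt : 0 <= beta t by rewrite mulr_ge0// (le_trans ler01)// log_level_ge1.
  by rewrite divr_ge0 ?(ltW psi_gt0)// mulr_ge0// mulr_ge0.
have g'0 : 0 < g' by apply: scope_fraction_gt0 => //; rewrite divr_gt0.
apply: (@le_trans _ _ (\sum_(1 <= a < 1 + k.*2) \sum_(1 <= s < t.+1)
    ((hata s w == a) && Q s)%:R)).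
  rewrite exchange_big/= big_nat [leRHS]big_nat; apply: ler_sum => s /andP[s1 st].
  rewrite -natr_sum ler_nat; rewrite -/(Q s); case Qs: (Q s) => //.
  have [/= /andP[h1 h2] _] := pullP s1.
  rewrite (big_rem (hata s w))/=; last first.
    rewrite mem_index_iota h1 add1n ltnS (leq_trans h2)//.
    by case/andP: Qs.
  by rewrite eqxx.
apply: (@le_trans _ _ (\sum_(1 <= a < 1 + k.*2)
    (1 + K * (g' / Num.max g' (gamma a w))))).
  rewrite big_nat [leRHS]big_nat; apply: ler_sum => a /andP[a1 _].
  apply: count_pulls_le.
    by rewrite mulr_ge0// divr_ge0 ?(ltW g'0)// le_max ltW.
  move=> s st sa /andP[kQ _].
  rewrite -sa; apply: (pulls_scope_le (b := b)) => //.
  by rewrite b1 (leq_trans bk).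
by rewrite big_split/= -mulr_sumr sum_const_seq mulr1.
Qed.

End run.

(** * Measurability of the run *)

Section measurability.
Context (R : realType) (d : measure_display) (T : measurableType d)
  (P : probability T R) (dV : measure_display) (TV : measurableType dV).
Variables (lam : R -> R) (zeta : R) (gamma : nat -> {RV P >-> R})
  (noise : nat -> nat -> {RV P >-> R}) (U : nat -> {RV P >-> R})
  (V : {mfun T >-> TV}) (bt : nat -> R) (hata hatr : nat -> T -> nat).
Hypothesis hlam : quantile_function lam.
Hypothesis hlambda0 : (lambda0 lam < +oo)%E.
Hypothesis hmodel : bandit_model zeta gamma noise U V.
Hypothesis hOSE : OSE_run (reward lam gamma noise) U V zeta bt hata hatr.

Let X := reward lam gamma noise.

Lemma measurable_mean_rank a : (1 <= a)%N ->
  measurable_fun setT (fun w => mean lam (gamma a w)).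
Proof.
move=> a1.
pose f (x : R) := mean lam (Num.min 1 (Num.max 0 x)).
have mf : measurable_fun setT f.
  apply: nonincreasing_measurable => // x y xy.
  apply: mean_nonincreasing => //.
  - by rewrite le_min ler01 le_max lexx.
  - by rewrite /Order.min /Order.max; case: (ltP 0 x) => ?; case: (ltP 0 y) => ?; repeat case: ltP => ?; move: xy; lra.
  - by rewrite ge_min lexx.
rewrite (_ : (fun w => _) = f \o gamma a).
  exact: measurableT_comp.
apply/funext => w /=; have /andP[g0 g1] := rank_range hmodel w a1.
by rewrite /f max_r// min_r.
Qed.

Lemma measurable_reward a n : (1 <= a)%N -> measurable_fun setT (X a n).
Proof. by move=> a1; apply: measurable_funD => //; exact: measurable_mean_rank. Qed.

Lemma measurable_nat_fun (f : T -> nat) :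
  (forall a, measurable (f @^-1` [set a])) -> measurable_fun setT f.
Proof.
move=> mf _ B _; rewrite setTI.
rewrite (_ : f @^-1` B = \bigcup_(a in B) f @^-1` [set a]).
  exact: bigcup_measurable.
apply/seteqP; split => [w Bw|w [a Ba /= fa]]; first by exists (f w).
by rewrite /= fa.
Qed.

(** A function with countably many values selects among measurable functions; only
    the indices in D, which the selector never leaves, have to be measurable. *)
Lemma measurable_select (f : T -> nat) (Y : nat -> T -> R) (D : set nat) :
    measurable_fun setT f -> (forall w, D (f w)) ->
    (forall a, D a -> measurable_fun setT (Y a)) ->
  measurable_fun setT (fun w => Y (f w) w).
Proof.
move=> mf fD mY _ B mB; rewrite setTI.
rewrite (_ : _ @^-1` B = \bigcup_(a in D) (f @^-1` [set a] `&` Y a @^-1` B)).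
  apply: bigcup_measurable => a Da; apply: measurableI.
    by rewrite -[X in measurable X]setTI; exact: mf.
  by rewrite -[X in measurable X]setTI; exact: mY.
apply/seteqP; split => [w Bw|w [a _ [/= <-]]//].
by exists (f w).
Qed.

Lemma measurable_pulls a t :
  (forall t', (1 <= t' <= t)%N -> measurable_fun setT (hata t')) ->
  measurable_fun setT (pulls hata a t).
Proof.
elim: t => [|t IH] mh.
  by rewrite (_ : pulls hata a 0 = cst 0%N)//; apply/funext => w; rewrite pulls_0.
rewrite (_ : pulls hata a t.+1 =
    (fun w => (pulls hata a t w + (hata t.+1 w == a))%N)); last first.
  by apply/funext => w; rewrite pulls_recr.
apply: measurable_fun_addn.
  by apply: IH => t' /andP[t1 tt]; apply: mh; rewrite t1 leqW.
have mE : measurable_fun setT (fun n : nat => nat_of_bool (n == a)) by [].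
by apply: (measurableT_comp mE); apply: mh; rewrite ltnS leqnn.
Qed.

Lemma hata_ge1 t w : (1 <= t)%N -> (1 <= hata t w)%N.
Proof. by move=> t1; have [/andP[]] := pull_argmax hOSE w t1. Qed.

Lemma measurable_observation t : (1 <= t)%N ->
  (forall t', (1 <= t' <= t)%N -> measurable_fun setT (hata t')) ->
  measurable_fun setT (observation X hata t).
Proof.
move=> t1 mh.
apply: (@measurable_select (hata t) (fun a w => X a (pulls hata a t w) w) [set a | (1 <= a)%N]).
- by apply: mh; rewrite t1 leqnn.
- by move=> w; exact: hata_ge1.
- move=> a a1.
  apply: (@measurable_select (pulls hata a t) (fun n => X a n) setT) => //.
    exact: measurable_pulls.
  by move=> n _; exact: measurable_reward.
Qed.

(** The pulls up to time k being measurable, so are the observations, hence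
    everything known to the learner; this is the induction step for the
    measurability of the pulls themselves. *)
Lemma known_measurable k t :
  (forall t', (1 <= t' <= k)%N -> measurable_fun setT (hata t')) ->
  known X U V hata k t `<=` measurable.
Proof.
move=> mh; apply: smallest_sub; first exact: sigma_algebra_measurable.
move=> A [| [t' _] | [t' tt] | [t' tt] ].
- exact: preimage_system_measurable.
- exact: preimage_system_measurable.
- by move=> [B _ <-]; exact: (mh t' tt).
- apply: preimage_system_measurable; apply: measurable_observation.
    by case/andP: tt.
  move=> s /andP[s1 st]; apply: mh; rewrite s1 (leq_trans st)//.
  by case/andP: tt.
Qed.

Lemma measurable_hata t : (1 <= t)%N -> measurable_fun setT (hata t).
Proof.
elim/ltn_ind: t => t IH t1; apply: measurable_nat_fun => a.
apply: (known_measurable _ (pull_adapted hOSE a t1)) => t' /andP[t1' tt'].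
by apply: IH => //; rewrite -(prednK t1) ltnS.
Qed.

Lemma measurable_hatr t : (1 <= t)%N -> measurable_fun setT (hatr t).
Proof.
move=> t1; apply: measurable_nat_fun => a.
apply: (known_measurable _ (recommend_adapted hOSE a t1)) => t' /andP[t1' _].
exact: measurable_hata.
Qed.

Lemma measurable_good_recommendation t e : (1 <= t)%N ->
  measurable [set w | (lambda0 lam - e%:E <= lambda lam (gamma (hatr t w) w))%E].
Proof.
move=> t1.
have m1 : measurable_fun setT (fun w => mean lam (gamma (hatr t w) w)).
  apply: (@measurable_select (hatr t) (fun a w => mean lam (gamma a w)) [set a | (1 <= a)%N]).
  - exact: measurable_hatr.
  - by move=> w; have [] := recommend_argmax hOSE w t1.
  - by move=> a; exact: measurable_mean_rank.
rewrite (_ : mkset _ = [set w | fine (lambda0 lam) - e <= mean lam (gamma (hatr t w) w)]).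
  exact: (measurable_set_le (f := cst _)).
have e0 : lambda0 lam = (fine (lambda0 lam))%:E.
  by rewrite fineK// lambda0_fin_num.
by apply/seteqP; split => w /=;
  rewrite lambda_mean// e0 -EFinB lee_fin.
Qed.

End measurability.

(** * Choice of the parameters *)

Section parameters.
Context (R : realType).

(** With this many arms, the expected number of ranks below p is at least 4 L. *)
Definition arm_horizon (L p : R) : nat := (Num.truncn (4 * L / p)).+1.
(** Exceeds 2 L, so that 2 to this power exceeds exp L = 5 t / delta, hence also
    1/p: all ranks are covered by the scales. *)
Definition rank_scales (L : R) : nat := (Num.truncn (2 * L)).+1.
(** A variable U_s at or above this value gives s^U_s >= k; adding log 2 / log s
    doubles the bound. *)
Definition window_start (k s : nat) : R := ln k%:R / ln s%:R.
(** A lower bound of log 2 / log s which is the same for all s <= t. *)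
Definition window_width (L : R) : R := 1 / (2 * L).

Lemma arm_horizon_itv (L p : R) : 1 <= L -> 0 < p -> p <= 1 ->
  4 * L <= (arm_horizon L p)%:R * p <= 5 * L.
Proof.
move=> L1 p0 p1; rewrite /arm_horizon.
have x0 : 0 <= 4 * L / p by rewrite divr_ge0 ?ltW// mulr_gt0//; lra.
have /andP[lo hi] := truncn_itv x0.
apply/andP; split; first by rewrite -ler_pdivrMr// ltW.
have : (Num.truncn (4 * L / p))%:R * p <= 4 * L by rewrite -ler_pdivlMr.
by rewrite -[in X in _ -> X]addn1 natrD mulrDl mul1r; lra.
Qed.

Lemma rank_scales_itv (L : R) : 1 <= L ->
  2 * L < (rank_scales L)%:R <= 3 * L.
Proof.
move=> L1; have x0 : 0 <= 2 * L by lra.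
have /andP[lo hi] := truncn_itv x0.
by rewrite /rank_scales hi/= -addn1 natrD; lra.
Qed.

Lemma half_le_ln2 : 1 / 2 <= ln 2 :> R.
Proof. by rewrite -ler_expR lnK ?posrE// expR_half_le2. Qed.

Section window.
Variables (k s : nat) (L : R).
Hypothesis k1 : (1 <= k)%N.
Hypothesis ks : (k.*2 <= s)%N.
Hypothesis L1 : 1 <= L.
Hypothesis sL : ln s%:R <= L.

Let s2 : (2 <= s)%N.
Proof. by apply: leq_trans ks; rewrite -[2%N]/(1.*2) leq_double. Qed.

Let lns0 : 0 < ln s%:R :> R.
Proof. by rewrite ln_gt0// ltr1n. Qed.

Let width_ln : window_width L * ln s%:R <= ln 2.
Proof.
apply: le_trans half_le_ln2; rewrite /window_width mulrAC ler_pdivrMr; last first.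
  by rewrite mulr_gt0 ?(lt_le_trans ltr01 L1).
by move: sL; lra.
Qed.

Let ln_double : ln k.*2%:R = ln 2 + ln k%:R :> R.
Proof. by rewrite -muln2 natrM lnM ?posrE ?ltr0n// addrC. Qed.

Lemma window_start_ge0 : 0 <= window_start k s.
Proof. by rewrite divr_ge0 ?ln_ge0 ?ler1n// ltnW. Qed.

Lemma window_end_le1 : window_start k s + window_width L <= 1.
Proof.
rewrite -(ler_pM2r lns0) mulrDl mul1r /window_start divfK ?gt_eqF//.
apply: (@le_trans _ _ (ln k.*2%:R)); first by rewrite ln_double addrC lerD2r.
by rewrite ler_ln ?posrE ?ltr0n ?double_gt0 ?ler_nat//; exact: ltnW.
Qed.

Lemma window_scope_size (T : Type) (U : nat -> T -> R) (w : T) :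
  window_start k s <= U s w <= window_start k s + window_width L ->
  (k <= scope_size U s w <= k.*2)%N.
Proof.
rewrite -(ler_pM2r lns0) -[X in _ && X](ler_pM2r lns0) mulrDl.
rewrite /window_start divfK ?gt_eqF// => /andP[lo hi].
have s0 : (s%:R == 0 :> R) = false by rewrite pnatr_eq0; case: (s) s2.
rewrite /scope_size /powR s0.
apply/andP; split.
  rewrite -[leqLHS](@natrK R); apply: le_truncn.
  by rewrite -[leLHS]lnK ?posrE ?ltr0n// ler_expR.
rewrite -[leqRHS](@natrK R); apply: le_truncn.
rewrite -[leRHS]lnK ?posrE ?ltr0n ?double_gt0// ler_expR ln_double.
by apply: (le_trans hi); rewrite addrC lerD2r.
Qed.

End window.

(** The probabilities of the failure events at time t are powers of
    exp (-L) = delta / (5 t): the cube for each of the 4 t noise deviations, the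
    square for each of the three other events. *)
Lemma tail_sum_le (delta t : R) : 0 < delta -> delta < 1 -> 1 <= t ->
  4 * t * (delta / (5 * t)) ^+ 3 + 3 * (delta / (5 * t)) ^+ 2 <=
  delta / (t * (t + 1)).
Proof.
move=> d0 d1 t1; have t0 : 0 < t by lra.
have -> : 4 * t * (delta / (5 * t)) ^+ 3 + 3 * (delta / (5 * t)) ^+ 2 =
   (4 * delta ^+ 3 + 15 * delta ^+ 2) / (125 * t ^+ 2).
  by field; rewrite gt_eqF.
apply: (@le_trans _ _ (19 * delta / (125 * t ^+ 2))).
  rewrite ler_pM2r ?invr_gt0 ?mulr_gt0 ?exprn_gt0//.
  have : delta ^+ 2 <= delta by rewrite expr2; nra.
  have : delta ^+ 3 <= delta ^+ 2 by rewrite [leLHS]exprS; nra.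
  lra.
rewrite ler_pdivrMr ?mulr_gt0 ?exprn_gt0// mulrAC ler_pdivlMr ?mulr_gt0//; last by lra.
rewrite [leLHS](_ : _ = delta * (19 * (t * t + t))); last by ring.
rewrite ler_pM2l// expr2; nra.
Qed.

Lemma telescoping_tail (delta : R) n : 0 <= delta ->
  \sum_(0 <= i < n) delta / (i.+1%:R * (i.+1%:R + 1)) <= delta.
Proof.
move=> d0.
have -> : \sum_(0 <= i < n) delta / (i.+1%:R * (i.+1%:R + 1)) =
    delta * (1 - n.+1%:R^-1).
  elim: n => [|n IH]; first by rewrite big_geq// invr1 subrr mulr0.
  rewrite big_nat_recr//= IH.
  have -> : n.+2%:R = n.+1%:R + 1 :> R by rewrite -addn1 natrD.
  have : 0 < n.+1%:R :> R by [].
  move: (n.+1%:R : R) => x x0.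
  by field; rewrite !gt_eqF//; lra.
by rewrite ler_piMr// gerBl.
Qed.

End parameters.

(** * The failure events *)

Lemma upper_half_end (t : nat) : ((t./2).+1 + (t - t./2) = t.+1)%N.
Proof. lia. Qed.

Lemma half_le_upper_half (t : nat) : (t <= (t - t./2) * 2)%N.
Proof. lia. Qed.

Lemma double_le_upper_half (k s t : nat) :
  (4 * k <= t)%N -> (t./2 < s)%N -> (k.*2 <= s)%N.
Proof. lia. Qed.

Section bad_events.
Context (R : realType) (d : measure_display) (T : measurableType d)
  (P : probability T R) (dV : measure_display) (TV : measurableType dV).
Variables (lam : R -> R) (zeta : R)
  (gamma : nat -> {RV P >-> R}) (noise : nat -> nat -> {RV P >-> R})
  (U : nat -> {RV P >-> R}) (V : {mfun T >-> TV})
  (hata hatr : nat -> T -> nat) (epsilon delta : R) (psi : nat -> R).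
Hypothesis hlam : quantile_function lam.
Hypothesis hzeta : 0 < zeta.
Hypothesis hmodel : bandit_model zeta gamma noise U V.
Hypothesis hlambda0 : (lambda0 lam < +oo)%E.
Hypothesis hepsilon : 0 < epsilon.
Hypothesis hdelta : 0 < delta < 1.
Hypothesis hpsi : forall t : nat, (1 <= t)%N ->
  2 ^+ 30 * ln (5 * t%:R / delta) ^+ 4 <= psi t.
Hypothesis hOSE : OSE_run (reward lam gamma noise) U V zeta
  (fun t : nat => 6 * ln (5 * t%:R / delta)) hata hatr.

Let p := scope_fraction lam (epsilon / 2).
Let L := log_level delta.
Let k t := arm_horizon (L t) p.
Let J t := rank_scales (L t).

Definition enough_time (t : nat) : Prop :=
  ((4 * psi t)%:E * complexity lam zeta epsilon <= t%:R%:E)%E.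

Definition noise_deviation (a n : nat) : set T := [set w |
  n%:R * Num.sqrt (zeta ^+ 2 * beta delta (maxn a n) / n%:R) <
  `| \sum_(1 <= s < n.+1) noise a s w | ].

(** The pairs (a, n) with maximum t: these events cover each pair exactly at the
    first time when the confidence bound involving it can be used, so that the
    union over t has summable probability. *)
Definition new_noise_deviation (t : nat) : set T :=
  \big[setU/set0]_(i < t) (noise_deviation i.+1 t `|` noise_deviation t i.+1).

Definition no_good_arm (t : nat) : set T :=
  [set w | forall a, (1 <= a <= k t)%N -> p <= gamma a w].

Definition inverse_rank_excess (t : nat) : set T := [set w |
  (k t).*2%:R * (2 * (J t)%:R * p) + 2 * L t <=
  \sum_(1 <= a < 1 + (k t).*2) p / Num.max p (gamma a w) / 2].

(** Only the second half of the times is counted: there, 2k <= s, so that the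
    window lies inside [0, 1]. *)
Definition thin_window (t : nat) : set T := [set w |
  \sum_((t./2).+1 <= s < (t./2).+1 + (t - t./2))
    \1_`[window_start R (k t) s, window_start R (k t) s + window_width (L t)] (U s w) <=
  (t - t./2)%:R * (window_width (L t) / 2) - 2 * L t].

(** The last three events are included only at times when the claim is made: a
    large t is what makes the last two of them unlikely. *)
Definition bad_event (t : nat) : set T := new_noise_deviation t `|`
  (if `[< enough_time t >]
   then no_good_arm t `|` inverse_rank_excess t `|` thin_window t else set0).

Let p_gt0 : 0 < p.
Proof. by apply: scope_fraction_gt0 => //; rewrite divr_gt0. Qed.

Let p_le1 : p <= 1.
Proof. by apply: scope_fraction_le1 => //; rewrite divr_ge0// ltW. Qed.

Let L_ge1 t : (1 <= t)%N -> 1 <= L t.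
Proof. by move=> t1; exact: log_level_ge1. Qed.

Let psi_gt0 t : (1 <= t)%N -> 0 < psi t.
Proof.
move=> t1; apply: lt_le_trans (hpsi t1); rewrite mulr_gt0 ?exprn_gt0//.
exact: lt_le_trans (L_ge1 t1).
Qed.

Lemma expR_log_level (n t : nat) : (1 <= t)%N ->
  expR (- (n%:R * L t)) = (delta / (5 * t%:R)) ^+ n.
Proof.
move=> t1; rewrite -mulrN expRM_natl expRN /L /log_level lnK ?posrE.
  by rewrite invf_div.
exact: log_level_arg.
Qed.

Lemma ln_time_le_log_level s t : (1 <= s)%N -> (s <= t)%N -> ln s%:R <= L t.
Proof.
move=> s1 st; case/andP: hdelta => d0 d1.
apply: (@le_trans _ _ (L s)); last exact: log_level_le.
have s0 : 1 <= s%:R :> R by rewrite ler1n.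
rewrite ler_ln ?posrE ?log_level_arg ?ltr0n// ler_pdivlMr//; nra.
Qed.

Lemma enough_time_scope t : (1 <= t)%N -> enough_time t ->
  4 * psi t <= t%:R * p.
Proof.
move=> t1 ht; apply: (complexity_cond hlam hlambda0 hzeta hepsilon _ ht).1.
by rewrite mulr_gt0// psi_gt0.
Qed.

(** Since psi_t dominates 20 L, the time is large compared to the number of arms
    considered. *)
Lemma horizon_le_time t : (1 <= t)%N -> enough_time t -> (4 * k t <= t)%N.
Proof.
move=> t1 ht; have L1 := L_ge1 t1.
have /andP[_ kp] := arm_horizon_itv L1 p_gt0 p_le1.
rewrite -(ler_nat R) natrM -(ler_pM2r p_gt0).
apply: le_trans (enough_time_scope t1 ht).
have h : 20 * L t <= 2 ^+ 30 * L t ^+ 4.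
  have L4 : L t <= L t ^+ 4.
    by rewrite exprS ler_peMr ?exprn_ege1//; lra.
  have M : 20 <= 2 ^+ 30 :> R.
    apply: (@le_trans _ _ (2 ^+ 5)); last by rewrite ler_eXn2l// ltr1n.
    by rewrite -natrX ler_nat.
  by apply: ler_pM => //; lra.
have := hpsi t1; rewrite -/(log_level delta t) -/(L t) => h'.
have := psi_gt0 t1; rewrite -/(k t) in kp.
have := le_trans h h'; move: kp; lra.
Qed.

Let y t : R := delta / (5 * t%:R).

Lemma noise_deviation_tail a n t : (1 <= a)%N -> (1 <= n)%N -> maxn a n = t ->
  (P (noise_deviation a n) <= (2 * y t ^+ 3)%:E)%E.
Proof.
move=> a1 n1 ant; have t1 : (1 <= t)%N by rewrite -ant leq_max a1.
rewrite /noise_deviation ant.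
have b0 : 0 < beta delta t by rewrite mulr_gt0// (lt_le_trans ltr01)// L_ge1.
apply: le_trans (noise_tail hzeta hmodel a1 n1 b0) _.
rewrite lee_fin ler_pM2l// -expR_log_level// ler_expR lerN2 /beta -/(L t); lra.
Qed.

Lemma new_noise_deviation_tail t : (1 <= t)%N ->
  (P (new_noise_deviation t) <= (4 * t%:R * y t ^+ 3)%:E)%E.
Proof.
move=> t1.
have mA i : measurable (noise_deviation i.+1 t `|` noise_deviation t i.+1).
  by apply: measurableU; exact: measurable_noise_deviation.
apply: (le_trans (Boole_inequality (A := fun i => noise_deviation i.+1 t `|` noise_deviation t i.+1) P _)) => //.
apply: (@le_trans _ _ (\sum_(i < t) (4 * y t ^+ 3)%:E)%E).
  apply: lee_sum => i _; apply: (le_trans (measureU2 _ _ _)).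
  - exact: measurable_noise_deviation.
  - exact: measurable_noise_deviation.
  have -> : (4 * y t ^+ 3)%:E = ((2 * y t ^+ 3)%:E + (2 * y t ^+ 3)%:E)%E.
    by rewrite -EFinD; congr EFin; ring.
  apply: leeD; apply: noise_deviation_tail => //.
    by apply/maxn_idPr; exact: ltn_ord.
  by apply/maxn_idPl; exact: ltn_ord.
rewrite sumEFin sumr_const card_ord lee_fin -[leLHS]mulr_natl.
by rewrite mulrA [_ * 4]mulrC.
Qed.

Lemma no_good_arm_tail t : (1 <= t)%N ->
  (P (no_good_arm t) <= (y t ^+ 2)%:E)%E.
Proof.
move=> t1; have /andP[kp _] := arm_horizon_itv (L_ge1 t1) p_gt0 p_le1.
rewrite -expR_log_level//; apply: (small_rank_tail hmodel).
  by rewrite (ltW p_gt0) p_le1.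
by move: kp; rewrite -/(k t); lra.
Qed.

Lemma inverse_rank_excess_tail t : (1 <= t)%N -> enough_time t ->
  (P (inverse_rank_excess t) <= (y t ^+ 2)%:E)%E.
Proof.
move=> t1 ht; rewrite -expR_log_level//; apply: (inverse_rank_tail hmodel) => //.
have /andP[J2 _] := rank_scales_itv (L_ge1 t1).
have lt_J := expR_lt_exp2 J2; rewrite -/(J t) in lt_J.
rewrite /L /log_level lnK ?posrE in lt_J; last exact: log_level_arg.
rewrite -(ltr_pM2r p_gt0) in lt_J; apply: le_lt_trans lt_J.
case/andP: hdelta => d0 d1.
have h1 := enough_time_scope t1 ht.
have h2 : 1 <= psi t.
  apply: le_trans (hpsi t1); rewrite -/(log_level delta t) -/(L t).
  by rewrite mulr_ege1// exprn_ege1// ?L_ge1// ler1n.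
have t0 : 1 <= t%:R :> R by rewrite ler1n.
rewrite mulrAC ler_pdivlMr//.
have : 0 < p := p_gt0; nra.
Qed.

Lemma thin_window_tail t : (1 <= t)%N -> enough_time t ->
  (P (thin_window t) <= (y t ^+ 2)%:E)%E.
Proof.
move=> t1 ht; rewrite -expR_log_level//.
have kt := horizon_le_time t1 ht.
apply: (window_tail hmodel) => s /andP[s1 s2].
- by apply: window_start_ge0 => //; lia.
- apply: window_end_le1 => //; [lia|exact: L_ge1|].
  by apply: ln_time_le_log_level; lia.
Qed.

Lemma measurable_bad_event t : measurable (bad_event t).
Proof.
apply: measurableU.
  apply: bigsetU_measurable => i _.
  by apply: measurableU; exact: measurable_noise_deviation.
case: asboolP => // _; apply: measurableU; first apply: measurableU.
- exact: measurable_no_small_rank.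
- exact: measurable_inverse_rank_sum.
- exact: measurable_window_count.
Qed.

Lemma bad_event_tail t : (1 <= t)%N ->
  (P (bad_event t) <= (delta / (t%:R * (t%:R + 1)))%:E)%E.
Proof.
move=> t1; case/andP: hdelta => d0 d1.
have mN : measurable (new_noise_deviation t).
  apply: bigsetU_measurable => i _.
  by apply: measurableU; exact: measurable_noise_deviation.
have y0 : 0 <= y t by rewrite divr_ge0 ?(ltW d0).
have tl := @tail_sum_le _ delta t%:R d0 d1 _.
apply: (@le_trans _ _ (4 * t%:R * y t ^+ 3 + 3 * y t ^+ 2)%:E); last first.
  by rewrite lee_fin; apply: tl; rewrite ler1n.
rewrite EFinD.
have mm := measurable_bad_event t.
rewrite /bad_event; case: asboolP => ht; last first.
  rewrite setU0; apply: (le_trans (new_noise_deviation_tail t1)).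
  by rewrite leeDl// lee_fin mulr_ge0// exprn_ge0.
have mA : measurable (no_good_arm t) by exact: measurable_no_small_rank.
have mB : measurable (inverse_rank_excess t) by exact: measurable_inverse_rank_sum.
have mC : measurable (thin_window t) by exact: measurable_window_count.
apply: (le_trans (measureU2 _ _ _)) => //; first by do 2 apply: measurableU => //.
apply: leeD; first exact: new_noise_deviation_tail.
have -> : (3 * y t ^+ 2)%:E = ((y t ^+ 2)%:E + (y t ^+ 2)%:E + (y t ^+ 2)%:E)%E.
  by rewrite -!EFinD; congr EFin; ring.
apply: (le_trans (measureU2 _ _ _)) => //; first exact: measurableU.
apply: leeD; last exact: thin_window_tail.
apply: (le_trans (measureU2 _ _ _)) => //.
by apply: leeD; [exact: no_good_arm_tail|exact: inverse_rank_excess_tail].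
Qed.

(** The pair (a, n) occurs in the event of time max(a, n). *)
Lemma concentration_off_bad_events w :
    (forall t, (1 <= t)%N -> ~ bad_event t w) ->
  forall a n, (1 <= a)%N -> (1 <= n)%N ->
  `| \sum_(1 <= s < n.+1) noise a s w | <=
  n%:R * Num.sqrt (zeta ^+ 2 * beta delta (maxn a n) / n%:R).
Proof.
move=> good a n a1 n1; rewrite leNgt; apply/negP => dev.
apply: (good (maxn a n)); first by rewrite leq_max a1.
left; rewrite /new_noise_deviation -(bigcup_mkord _ (fun i =>
  noise_deviation i.+1 (maxn a n) `|` noise_deviation (maxn a n) i.+1)).
have [an|na] := leqP a n.
  by exists a.-1 => /=; [lia|rewrite prednK//; left].
exists n.-1 => /=; first lia.
by rewrite prednK//; right.
Qed.

(** A bad recommendation at time t would bound the number of times with a scope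
    between k and 2k from above, against the lower bound that holds off the
    failure events. *)
Lemma good_recommendation_off_bad_events w :
    (forall t, (1 <= t)%N -> ~ bad_event t w) ->
  forall t, (1 <= t)%N -> enough_time t ->
  (lambda0 lam - epsilon%:E <= lambda lam (gamma (hatr t w) w))%E.
Proof.
move=> off t t1 ht.
rewrite (lambda_mean hlam hlambda0) -(fineK (lambda0_fin_num hlam hlambda0)).
rewrite -EFinB lee_fin leNgt; apply/negP => lt_mean.
have bad : epsilon < gap lam (gamma (hatr t w) w) by rewrite /gap; move: lt_mean; lra.
have := off t t1; rewrite /bad_event; case: asboolP => // _.
move=> /not_orP[_ /not_orP[/not_orP[some_good no_excess] not_thin]].
have L1 := L_ge1 t1.
have L0 : 0 < L t by exact: lt_le_trans L1.
have kt := horizon_le_time t1 ht.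
have k1 : (1 <= k t)%N by [].
have [b b1 gb] : exists2 b, (1 <= b <= k t)%N & gamma b w < p.
  apply: contrapT => none; apply: some_good => a a1.
  by rewrite leNgt; apply/negP => ga; apply: none; exists a.
have /andP[b0 bk] := b1.
have good_b : gap lam (gamma b w) <= epsilon / 2.
  have e0 : 0 <= epsilon / 2 by rewrite divr_ge0// ltW.
  have /andP[g0 _] := rank_range hmodel w b0.
  exact: (lt_scope_fraction_gap hlam hlambda0 e0 g0 gb).
have := scope_window_le hlam hlambda0 hzeta hdelta
  (fun a a1 => rank_range hmodel w a1) (fun s s1 => scope_range hmodel w s1)
  (concentration_off_bad_events off)
  (fun s s1 => pull_argmax hOSE w s1) (fun s s1 => recommend_argmax hOSE w s1)
  hepsilon (psi_gt0 t1) t1 ht bad b1 good_b.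
rewrite -/p.
set N := \sum_(1 <= s < t.+1) _.
set S := \sum_(1 <= a < 1 + (k t).*2) _ => N_le.
have S_lt : S / 2 <= (k t).*2%:R * (2 * (J t)%:R * p) + 2 * L t.
  by rewrite /S mulr_suml ltW// ltNge; apply/negP => h; exact: no_excess.
have N_gt : (t - t./2)%:R * (window_width (L t) / 2) - 2 * L t < N.
  rewrite ltNge; apply/negP => N_small; apply: not_thin; apply: le_trans N_small.
  have half_lt : ((t./2).+1 <= t.+1)%N by rewrite -(upper_half_end t) leq_addr.
  rewrite /N upper_half_end [leRHS](big_cat_nat (n := (t./2).+1))//=.
  rewrite ler_wpDl ?sumr_ge0// big_nat [leRHS]big_nat; apply: ler_sum => s /andP[s1 s2].
  rewrite indicE; case: (boolP (_ \in _)) => // /set_mem /=; rewrite in_itv/= => us.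
  rewrite (window_scope_size (L := L t) (k := k t)) ?ler1n//.
    exact: double_le_upper_half kt s1.
  by apply: ln_time_le_log_level => //; exact: leq_trans s1.
have /andP[kp5 kp] := arm_horizon_itv L1 p_gt0 p_le1.
have /andP[_ J3] := rank_scales_itv L1.
apply: (@few_pulls_absurd R (L t) p t%:R (psi t) (k t)%:R (J t)%:R S) => //.
- exact: hpsi.
- exact: enough_time_scope.
- by move: S_lt; rewrite -muln2 natrM; lra.
- have half : t%:R / 2 <= (t - t./2)%:R :> R.
    by rewrite ler_pdivrMr// -natrM ler_nat half_le_upper_half.
  have q0 : 0 <= window_width (L t) / 2 by rewrite divr_ge0// divr_ge0// ltW// mulr_gt0.
  have := ler_wpM2r q0 half; rewrite /window_width => hw.
  move: N_le; rewrite /beta -/(L t) -muln2 natrM [_ * 2]mulrC => N_le.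
  by apply: (le_lt_trans _ (lt_le_trans N_gt N_le)); rewrite lerD2r.
Qed.

Lemma bad_events_total :
  (P (\bigcup_n bad_event n.+1) <= delta%:E)%E.
Proof.
have mb n : measurable (bad_event n.+1) by exact: measurable_bad_event.
apply: (le_trans (generalized_Boole_inequality P mb _)).
  exact: bigcup_measurable.
apply: lime_le; first by apply: is_cvg_nneseries.
apply: nearW => n; case/andP: hdelta => d0 _.
apply: (@le_trans _ _ (\sum_(0 <= i < n) (delta / (i.+1%:R * (i.+1%:R + 1)))%:E)%E).
  by apply: lee_sum => i _; exact: bad_event_tail.
by rewrite sumEFin lee_fin telescoping_tail// ltW.
Qed.

End bad_events.

Theorem corollary4p1 (R : realType) (d : measure_display)
    (T : measurableType d) (P : probability T R)
    (dV : measure_display) (TV : measurableType dV)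
    (lam : R -> R) (zeta : R)
    (gamma : nat -> {RV P >-> R}) (noise : nat -> nat -> {RV P >-> R})
    (U : nat -> {RV P >-> R}) (V : {mfun T >-> TV})
    (hata hatr : nat -> T -> nat) (epsilon delta : R) (psi : nat -> R)
    (hlam : quantile_function lam)
    (hzeta : 0 < zeta)
    (hmodel : bandit_model zeta gamma noise U V)
    (hlambda0 : (lambda0 lam < +oo)%E)
    (hepsilon : 0 < epsilon)
    (hdelta : 0 < delta < 1)
    (hpsi : forall t : nat, (1 <= t)%N ->
      2 ^+ 30 * ln (5 * t%:R / delta) ^+ 4 <= psi t)
    (hOSE : OSE_run (reward lam gamma noise) U V zeta
      (fun t : nat => 6 * ln (5 * t%:R / delta)) hata hatr) :
  ((1 - delta)%:E <=
    P [set w | forall t : nat, (1 <= t)%N ->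
         ((4 * psi t)%:E * complexity lam zeta epsilon <= t%:R%:E)%E ->
         (lambda0 lam - epsilon%:E <= lambda lam (gamma (hatr t w) w))%E])%E.

Proof.
set G := [set w | _].
have mG : measurable G.
  rewrite (_ : G = \bigcap_(t in [set t | (1 <= t)%N /\ enough_time lam zeta epsilon psi t])
    [set w | (lambda0 lam - epsilon%:E <= lambda lam (gamma (hatr t w) w))%E]).
    apply: bigcap_measurableType => t [t1 _].
    exact: (measurable_good_recommendation hlam hlambda0 hmodel hOSE).
  apply/seteqP; split => w /= Gw t; first by case=> t1 ht; exact: Gw.
  by move=> t1 ht; apply: (Gw t); split.
pose B := \bigcup_n bad_event lam zeta gamma noise U epsilon delta psi n.+1.
have mB : measurable B.
  by apply: bigcup_measurable => n _; exact: measurable_bad_event.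
have PB : (P B <= delta%:E)%E by apply: (bad_events_total (V := V)).
apply: (@le_trans _ _ (P (~` B))).
  rewrite probability_setC// EFinB leeB//.
apply: le_measure; rewrite ?inE//; first exact: measurableC.
move=> w nB t t1 ht.
apply: (good_recommendation_off_bad_events hlam hzeta hmodel hlambda0 hepsilon
  hdelta hpsi hOSE _ t1 ht).
by move=> [//|s] _ bs; apply: nB; exists s.
Qed.
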